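(* Let $0\le\ell\le n/2$, let $A_1\in\widetilde{\mathcal{S}}_{k_1}$, $A_2\in\widetilde{\mathcal{S}}_{k_2}$ for positive integers $k_1,k_2$, and for $j=1,2$ define the formal hypersurfaces in $\mathbb{C}^{n+1}$ $$M_j^0:=\{\operatorname{Im}w=\langle z,\bar z\rangle_\ell+A_j^0(z,\bar z,u)\},\qquad M_j:=\{\operatorname{Im}w=\langle z,\bar z\rangle_\ell+A_j(z,\bar z,w,\bar w)\},$$ where $u=\operatorname{Re}w$ and $A_j^0(z,\bar z,u):=A_j(z,\bar z,w,\bar w)|_{w=u+i\langle z,\bar z\rangle_\ell}$. Let $$H(z,w)=(z+f(z,w),\,w+g(z,w))$$ be a formal biholomorphic map with $H(0)=0$ and with $(f,g)$ satisfying the normalization condition $$\frac{\partial(f,g)}{\partial(z,w)}(0)=0,\qquad\operatorname{Re}\Big(\frac{\partial^2g}{\partial w^2}\Big)(0)=0,$$ and which sends $M_1$ into $M_2$ (or $M_1^0$ into $M_2^0$). Then, if $k_1+k_2<n$, it must hold that $H(z,w)\equiv(z,w)$ and $A_1\equiv A_2$.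
   Context: Notation: $(z,w)\in\mathbb{C}^n\times\mathbb{C}$, $\langle a,b\rangle_\ell:=-\sum_{j=1}^{\ell}a_jb_j+\sum_{j=\ell+1}^n a_jb_j$ for $a,b\in\mathbb{C}^n$. When $w=u+i\langle z,\bar z\rangle_\ell$ is substituted, $\bar w=u-i\langle z,\bar z\rangle_\ell$. $\mathcal{O}$ is the space of real-valued formal power series in $(z,\bar z,w,\bar w)$ vanishing of order at least $2$ at $0$. A formal power series is expanded as $A(z,\bar z,w,\bar w)=\sum_{\mu,\nu,\gamma,\delta}A_{\mu\nu\gamma\delta}(z,\bar z)w^\gamma\bar w^\delta$, where $A_{\mu\nu\gamma\delta}$ is a bihomogeneous polynomial in $(z,\bar z)$ of bidegree $(\mu,\nu)$. The rank $\mathrm{R}(B)$ of a formal power series $B(Z,\bar Z)$ is $\dim_{\mathbb{C}}\operatorname{span}_{\mathbb{C}}\{\frac{\partial^\alpha B}{\partial\bar Z^\alpha}(Z,0)\}_\alpha$, $\alpha$ running over all multi-indices. For every positive integer $k$, $\widetilde{\mathcal{S}}_k\subset\mathcal{O}$ is the set of all real-valued formal power series $A(z,\bar z,w,\bar w)$ such that $A_{\mu\nu\gamma\delta}=0$ if $\nu+\delta\le1$, and $\mathrm{R}(A_{\mu\nu\gamma\delta})\le k$ otherwise. Equivalently: for each fixed $(\mu,\nu,\gamma,\delta)$, one can write $A_{\mu\nu\gamma\delta}(z,\bar z)w^\gamma\bar w^\delta=\sum_{j=1}^k\phi_j(z,w)\overline{\psi_j(z,w)}$ for some holomorphic polynomials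 $\phi_j,\psi_j$ with no constant or linear terms. A formal holomorphic map $H$ with $H(0)=0$ sends a formal hypersurface $\{\rho_1(Z,\bar Z)=0\}$ into $\{\rho_2(Z,\bar Z)=0\}$ if $\rho_2(H(Z),\overline{H(Z)})$ is a multiple of $\rho_1(Z,\bar Z)$ in the ring of formal power series in $(Z,\bar Z)$. *)

(* Defs.v *)
From HB Require Import structures.
From mathcomp Require Import all_boot all_order all_algebra.
From mathcomp Require Import boolp reals.
From mathcomp Require Import mpoly complex.

Set Implicit Arguments.
Unset Strict Implicit.
Unset Printing Implicit Defensive.

Import Order.TTheory GRing.Theory Num.Theory.
Local Open Scope ring_scope.

(* The series are wrapped in a record so that they do not inherit the         *)
(* pointwise operations on functions.                                        *)
Record fps (K : comNzRingType) (m : nat) := Fps { fcoef :> 'X_{1..m} -> K }.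

HB.instance Definition _ K m := gen_eqMixin (fps K m).
HB.instance Definition _ K m := gen_choiceMixin (fps K m).

Section FpsRing.
Variables (K : comNzRingType) (m : nat).
Implicit Types (f g h : fps K m) (a b : 'X_{1..m}) (c : K).

Lemma fpsP f g : f =1 g -> f = g.
Proof. by case: f g => [f] [g] /= fg; congr Fps; exact: funext. Qed.

Definition fps_zero : fps K m := Fps (fun=> 0).
Definition fps_opp f : fps K m := Fps (fun a => - f a).
Definition fps_add f g : fps K m := Fps (fun a => f a + g a).
Definition fps_scale c f : fps K m := Fps (fun a => c * f a).
Definition fps_mono b : fps K m := Fps (fun a => (b == a)%:R).
Definition fps_mul f g : fps K m := Fps (fun a =>
  \sum_(k : 'X_{1..m < (mdeg a).+1, (mdeg a).+1} | a == (k.1 + k.2)%MM)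
     f k.1 * g k.2).

Fact fps_addA : associative fps_add.
Proof. by move=> f g h; apply: fpsP => a /=; rewrite addrA. Qed.
Fact fps_addC : commutative fps_add.
Proof. by move=> f g; apply: fpsP => a /=; rewrite addrC. Qed.
Fact fps_add0 : left_id fps_zero fps_add.
Proof. by move=> f; apply: fpsP => a /=; rewrite add0r. Qed.
Fact fps_addN : left_inverse fps_zero fps_opp fps_add.
Proof. by move=> f; apply: fpsP => a /=; rewrite addNr. Qed.

HB.instance Definition _ :=
  GRing.isZmodule.Build (fps K m) fps_addA fps_addC fps_add0 fps_addN.

Definition ftrunc (d : nat) f : {mpoly K[m]} :=
  \sum_(k : 'X_{1..m < d}) f k *: 'X_[k].

Lemma mcoeff_ftrunc d f a : (mdeg a < d)%N -> (ftrunc d f)@_a = f a.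
Proof. by move=> lt_ad; rewrite /ftrunc (mcoeff_mpoly f). Qed.

Lemma fps_mulE d f g a : (mdeg a < d)%N ->
  fps_mul f g a = (ftrunc d f * ftrunc d g)@_a.
Proof.
move=> lt_ad; transitivity ((ftrunc (mdeg a).+1 f * ftrunc (mdeg a).+1 g)@_a).
  rewrite /= mcoeffM; apply: eq_bigr => k _.
  by rewrite !mcoeff_ftrunc // bmdeg.
rewrite !mcoeffM; apply: eq_bigr => k _.
by rewrite !mcoeff_ftrunc //; apply: leq_trans (bmdeg _) _.
Qed.

Lemma eq_mcoeffM d (p p' q q' : {mpoly K[m]}) a : (mdeg a < d)%N ->
  (forall b, (mdeg b < d)%N -> p@_b = p'@_b) ->
  (forall b, (mdeg b < d)%N -> q@_b = q'@_b) -> (p * q)@_a = (p' * q')@_a.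
Proof.
move=> lt_ad pp qq; rewrite !mcoeffM; apply: eq_bigr => k _.
by rewrite pp ?qq //; apply: leq_trans (bmdeg _) _.
Qed.

Fact fps_mulA : associative fps_mul.
Proof.
move=> f g h; apply: fpsP => a; have lt_a := ltnSn (mdeg a).
rewrite !(fps_mulE _ _ lt_a).
have E f1 f2 b : (mdeg b < (mdeg a).+1)%N ->
    (ftrunc (mdeg a).+1 (fps_mul f1 f2))@_b
    = (ftrunc (mdeg a).+1 f1 * ftrunc (mdeg a).+1 f2)@_b.
  by move=> lt_b; rewrite mcoeff_ftrunc // (fps_mulE _ _ lt_b).
transitivity ((ftrunc (mdeg a).+1 f
  * (ftrunc (mdeg a).+1 g * ftrunc (mdeg a).+1 h))@_a).
  by apply: (eq_mcoeffM lt_a) => // b; exact: E.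
by rewrite mulrA; symmetry; apply: (eq_mcoeffM lt_a) => // b; exact: E.
Qed.

Fact fps_mulC : commutative fps_mul.
Proof.
move=> f g; apply: fpsP => a; have lt_a := ltnSn (mdeg a).
by rewrite !(fps_mulE _ _ lt_a) mulrC.
Qed.

Fact fps_mul1 : left_id (fps_mono 0%MM) fps_mul.
Proof.
move=> f; apply: fpsP => a; have lt_a := ltnSn (mdeg a).
rewrite (fps_mulE _ _ lt_a) (@eq_mcoeffM _ _ 1 _ (ftrunc (mdeg a).+1 f) _ lt_a) //.
  by rewrite mul1r mcoeff_ftrunc.
by move=> b lt_b; rewrite mcoeff_ftrunc //= mcoeff1 eq_sym.
Qed.

Fact fps_mulDl : left_distributive fps_mul fps_add.
Proof.
move=> f g h; apply: fpsP => a /=.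
by rewrite -big_split; apply: eq_bigr => k _; rewrite mulrDl.
Qed.

Fact fps_1_neq0 : fps_mono 0%MM != 0.
Proof.
apply/eqP => /(congr1 (fun f : fps K m => f 0%MM)) /=.
by rewrite eqxx => /eqP; rewrite oner_eq0.
Qed.

HB.instance Definition _ := GRing.Zmodule_isComNzRing.Build (fps K m)
  fps_mulA fps_mulC fps_mul1 fps_mulDl fps_1_neq0.

Fact fps_scaleA c1 c2 f :
  fps_scale c1 (fps_scale c2 f) = fps_scale (c1 * c2) f.
Proof. by apply: fpsP => a /=; rewrite mulrA. Qed.
Fact fps_scale1 : left_id 1 fps_scale.
Proof. by move=> f; apply: fpsP => a /=; rewrite mul1r. Qed.
Fact fps_scaleDr : right_distributive fps_scale +%R.
Proof. by move=> c f g; apply: fpsP => a /=; rewrite mulrDr. Qed.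
Fact fps_scaleDl f : {morph fps_scale^~ f : c1 c2 / c1 + c2}.
Proof. by move=> c1 c2; apply: fpsP => a /=; rewrite mulrDl. Qed.

HB.instance Definition _ := GRing.Zmodule_isLmodule.Build K (fps K m)
  fps_scaleA fps_scale1 fps_scaleDr fps_scaleDl.

Definition fvar (i : 'I_m) : fps K m := fps_mono U_(i)%MM.

Definition fcst f : K := f 0%MM.

(* Iterated partial derivative, with the same coefficients as p^`M[b] in      *)
(* mpoly (lemma mcoeff_mderivm).                                             *)
Definition fderivm b f : fps K m := Fps (fun a =>
  f (b + a)%MM *+ \prod_(i < m) ((b + a)%MM i) ^_ (b i)).

End FpsRing.

(* Substitution F(G_0, ..., G_(p-1)).  It is only meaningful when the G_i     *)
(* have no constant term: then a monomial X^b contributes to the coefficient *)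
(* of Y^a only if |b| <= |a|.                                                *)
Definition fcomp (K : comNzRingType) (p q : nat) (F : fps K p)
    (G : 'I_p -> fps K q) : fps K q :=
  Fps (fun a => \sum_(b : 'X_{1..p < (mdeg a).+1})
                   F b * (\prod_(i < p) G i ^+ b i) a).

Definition cat_fun (T : Type) (p q : nat) (u : 'I_p -> T) (v : 'I_q -> T)
    (i : 'I_(p + q)) : T :=
  match split i with inl j => u j | inr j => v j end.

Definition mcat (p q : nat) (a : 'X_{1..p}) (b : 'X_{1..q}) : 'X_{1..p + q} :=
  [multinom cat_fun a b i | i < p + q].
Definition mleft (p q : nat) (c : 'X_{1..p + q}) : 'X_{1..p} :=
  [multinom c (lshift q i) | i < p].
Definition mright (p q : nat) (c : 'X_{1..p + q}) : 'X_{1..q} :=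
  [multinom c (rshift p i) | i < q].

Section Dimension.
Variables (K : comNzRingType) (V : lmodType K).

Definition span_of (I : Type) (v : I -> V) (x : V) : Prop :=
  exists (r : nat) (s : 'I_r -> I) (c : 'I_r -> K),
    x = \sum_(i < r) c i *: v (s i).

Definition has_dim (W : V -> Prop) (r : nat) : Prop :=
  exists b : 'I_r -> V,
    [/\ forall i, W (b i),
        forall c : 'I_r -> K,
          \sum_(i < r) c i *: b i = 0 -> forall i, c i = 0
      & forall x, W x -> exists c : 'I_r -> K, x = \sum_(i < r) c i *: b i].

End Dimension.

Definition Cplx (R : realType) : numClosedFieldType :=
  [the numClosedFieldType of R[i]].

(* Series in (Z, Zbar): elements of fps C (m + m), where the variable        *)
(* lshift m i stands for Z_i and rshift m i for Zbar_i.                      *)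
Section Hermitian.
Variables (C : numClosedFieldType) (m : nat).

(* Conjugation: the coefficient of Z^a Zbar^b in the conjugate of B is the    *)
(* conjugate of the coefficient of Z^b Zbar^a in B.                          *)
Definition fbar (B : fps C (m + m)) : fps C (m + m) :=
  Fps (fun c => (B (mcat (mright c) (mleft c)))^*).

Definition real_valued (B : fps C (m + m)) : Prop := fbar B = B.

Definition holo (h : fps C m) : fps C (m + m) :=
  fcomp h (fun i => fvar C (lshift m i)).

Definition at_Zbar0 (B : fps C (m + m)) : fps C m :=
  fcomp B (cat_fun (fun i => fvar C i) (fun=> 0)).

(* The dimension of the span of the series d^a B / d Zbar^a (Z, 0) is r.      *)
Definition rank_is (B : fps C (m + m)) (r : nat) : Prop :=
  has_dim (span_of (fun a : 'X_{1..m} => at_Zbar0 (fderivm (mcat 0%MM a) B))) r.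

Definition rank_le (B : fps C (m + m)) (k : nat) : Prop :=
  exists2 r, (r <= k)%N & rank_is B r.

Definition formal_map_biholomorphic (H : 'I_m -> fps C m) : Prop :=
  (forall i, fcst (H i) = 0) /\
  exists G : 'I_m -> fps C m,
    [/\ forall i, fcst (G i) = 0,
        forall i, fcomp (G i) H = fvar C i
      & forall i, fcomp (H i) G = fvar C i].

Definition sends_into (H : 'I_m -> fps C m) (rho1 rho2 : fps C (m + m)) : Prop :=
  exists q : fps C (m + m),
    fcomp rho2 (cat_fun (fun i => holo (H i)) (fun i => fbar (holo (H i))))
    = q * rho1.

End Hermitian.

(* Here Z = (z, w) with z in C^n and w in C, so that Z_(lshift 1 j) = z_j    *)
(* and Z_(rshift n ord0) = w.                                                *)

Section Hypersurfaces.
Variables (C : numClosedFieldType) (n : nat).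
Local Notation N := (n + 1)%N.

Definition iz (j : 'I_n) : 'I_N := lshift 1 j.
Definition iw : 'I_N := rshift n ord0.

Definition vz (j : 'I_n) : fps C (N + N) := fvar C (lshift N (iz j)).
Definition vw : fps C (N + N) := fvar C (lshift N iw).
Definition vzb (j : 'I_n) : fps C (N + N) := fvar C (rshift N (iz j)).
Definition vwb : fps C (N + N) := fvar C (rshift N iw).

Definition re_w : fps C (N + N) := 2^-1 *: (vw + vwb).
Definition im_w : fps C (N + N) := (2 * 'i)^-1 *: (vw - vwb).

(* < z, zbar >_l *)
Definition lform (l : nat) : fps C (N + N) :=
  - \sum_(j < n | (j < l)%N) vz j * vzb j
  + \sum_(j < n | (l <= j)%N) vz j * vzb j.

(* The coefficient A_{mu nu gamma delta}(z, zbar) of w^gamma wbar^delta, of   *)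
(* bidegree (mu, nu), as a series in the 2n variables (z, zbar).             *)
Definition bicomp (A : fps C (N + N)) (mu nu gamma delta : nat) :
    fps C (n + n) :=
  Fps (fun c =>
    if (mdeg (mleft c) == mu) && (mdeg (mright c) == nu)
    then A (mcat (mcat (mleft c) [multinom gamma | i < 1])
                 (mcat (mright c) [multinom delta | i < 1]))
    else 0).

Definition spaceO (A : fps C (N + N)) : Prop :=
  real_valued A /\ forall c : 'X_{1..N + N}, (mdeg c < 2)%N -> A c = 0.

Definition tildeS (k : nat) (A : fps C (N + N)) : Prop :=
  spaceO A /\
  forall mu nu gamma delta : nat,
    if (nu + delta <= 1)%N then bicomp A mu nu gamma delta = 0
    else rank_le (bicomp A mu nu gamma delta) k.

(* Defining series of Im w = < z, zbar >_l + A(z, zbar, w, wbar). *)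
Definition rho (l : nat) (A : fps C (N + N)) : fps C (N + N) :=
  im_w - (lform l + A).

(* A^0(z, zbar, u) with u = Re w: the substitution w = u + i< z, zbar >_l,    *)
(* wbar = u - i< z, zbar >_l in A.                                           *)
Definition restr0 (l : nat) (A : fps C (N + N)) : fps C (N + N) :=
  fcomp A (cat_fun (cat_fun vz (fun=> re_w + 'i *: lform l))
                   (cat_fun vzb (fun=> re_w - 'i *: lform l))).

Definition rho0 (l : nat) (A : fps C (N + N)) : fps C (N + N) :=
  rho l (restr0 l A).

(* (z, w) |-> (z + f(z, w), w + g(z, w)) *)
Definition pert_id (f : 'I_n -> fps C N) (g : fps C N) : 'I_N -> fps C N :=
  cat_fun (fun j => fvar C (iz j) + f j) (fun=> fvar C iw + g).

Definition normalized (f : 'I_n -> fps C N) (g : fps C N) : Prop :=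
  [/\ forall j i, fcst (fderivm U_(i)%MM (f j)) = 0,
      forall i, fcst (fderivm U_(i)%MM g) = 0
    & 'Re (fcst (fderivm (U_(iw) + U_(iw))%MM g)) = 0].

End Hypersurfaces.

(* Main.v *)
Require Import Defs.
From mathcomp Require Import all_boot all_order all_algebra.
From mathcomp Require Import boolp reals.
From mathcomp Require Import mpoly complex.
From mathcomp Require Import ring zify.

Set Implicit Arguments.
Unset Strict Implicit.
Unset Printing Implicit Defensive.

Import Order.TTheory GRing.Theory Num.Theory.
Local Open Scope ring_scope.

(** Why a normalized map must be the identity.

Give z, zbar the weight 1 and w, wbar the weight 2, and put
sigma = w - wbar - 2i <z, zbar>, which is homogeneous of weight 2.  Write the
factor in the mapping equation as 1 + Q.  After multiplication by 2i, the
equation says that the Chern-Moser operator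
  g - conj g - 2i (<f, zbar> + <z, conj f>) - 2i (A2 - A1)
equals Q sigma plus nonlinear terms ([mapping_equation]).  The series A1 and A2
only contain monomials of degree at least 2 in (z, w) and at least 2 in the
conjugate variables, hence have weight at least 4, and f has weight at least 2.
So, when f, g, A2 - A1 and Q vanish below the weights s - 1, s, s and s - 2, the
nonlinear terms vanish up to weight s included.  Induction on s
([rigidity_wge]) thus reduces the theorem to its linearization in a single
weight, [linear_rigidity].

For the linear statement, compare the coefficients of
z^a w^ga zbar^b wbar^de.  Multiplication by sigma is a three-term recursion on
the coefficients of Q: one term lowers ga, one lowers de, and the third is the
product with <z, zbar>.  Run by increasing ga + de, the recursion leaves in each
bidegree an identity between <z, zbar> times a component of Q and a component of
A2 - A1.  The latter has rank at most k1 + k2 < n, whereas a nonzero multiple of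
<z, zbar> has rank at least n ([form_mul_rank], a lemma of Huang), so that
component of Q is zero.  What survives is a sum a(z, w) + b(zbar, wbar).  Terms
of degree 1 in wbar and 0 in zbar, and their conjugates, are absent from the
left-hand side, and this leaves only r (w + wbar) and a constant: the first is
the infinitesimal automorphism (f, g) = r (z w, w^2) of the quadric, removed by the
condition on Re g_ww (0), and the second is removed by g_w (0) = 0.  Once Q = 0, the three unknowns f, g and
A2 - A1 vanish, because they fill disjoint sets of monomials.

The substitution w = u + i <z, zbar>, wbar = u - i <z, zbar> preserves weights
and changes a series by a multiple of sigma, which can be absorbed in Q; the
hypersurfaces M_j^0 are therefore covered by the same argument.  This is the
role of [restriction_like]. *)

(** * Weights and substitution in formal power series *)

Section FpsBasics.
Variables (K : comNzRingType) (m : nat).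
Implicit Types (f g h : fps K m) (a b c : 'X_{1..m}) (w : 'I_m -> nat).

Lemma fpsD f g a : (f + g) a = f a + g a. Proof. by []. Qed.
Lemma fpsN f a : (- f) a = - f a. Proof. by []. Qed.
Lemma fpsB f g a : (f - g) a = f a - g a. Proof. by []. Qed.
Lemma fpsZ k f a : (k *: f) a = k * f a. Proof. by []. Qed.

Lemma fps_sum (I : Type) (r : seq I) (P : pred I) (F : I -> fps K m) a :
  (\sum_(i <- r | P i) F i) a = \sum_(i <- r | P i) F i a.
Proof. by elim/big_rec2: _ => // i x y _ <-. Qed.

Lemma fps_scale_mull k f g : (k *: f) * g = k *: (f * g).
Proof.
apply: fpsP => a; rewrite fpsZ /= mulr_sumr.
by apply: eq_bigr => i _; rewrite mulrA.
Qed.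

(** Products by monomials are the only ones whose coefficients are needed explicitly. *)
Lemma fps_monoM b h a :
  (fps_mono K b * h) a = if (b <= a)%MM then h (a - b)%MM else 0.
Proof.
rewrite /=; case: ifP => [le_ba|Nle_ba]; last first.
  apply: big1 => -[k1 k2] /= /eqP ak; case: eqP => [ebk|]; last by rewrite mul0r.
  by have := lem_addr k1 k2; rewrite -ak -ebk Nle_ba.
have lt1 : (mdeg b < (mdeg a).+1)%N by rewrite ltnS -[X in (_ <= mdeg X)%N](submK le_ba) mdegD leq_addl.
have lt2 : (mdeg (a - b) < (mdeg a).+1)%N by rewrite ltnS mdegB.
rewrite (bigD1 (BMultinom lt1, BMultinom lt2)) /=; last by rewrite addmC submK.
rewrite eqxx mul1r big1 ?addr0 // => -[k1 k2] /= /andP[/eqP ak ne_k].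
case: eqP => [ebk|]; last by rewrite mul0r.
case/eqP: ne_k; congr pair; apply: val_inj => //=.
by rewrite ebk [X in (X - _)%MM]ak [X in (X - _)%MM]addmC addmK.
Qed.

Lemma fps_monoD b c : fps_mono K b * fps_mono K c = fps_mono K (b + c).
Proof.
apply: fpsP => a; rewrite fps_monoM /=; case: ifP => [le_ba|Nle_ba].
  by rewrite -(eqm_add2r b) submK // [(c + b)%MM]addmC.
by case: eqP => // eba; rewrite -eba lem_addr in Nle_ba.
Qed.

Lemma fps_monoX b (p : nat) : fps_mono K b ^+ p = fps_mono K (b *+ p).
Proof. by elim: p => // p IH; rewrite exprS IH fps_monoD mulmS. Qed.

Lemma fps_mono_prod (I : Type) (r : seq I) (P : pred I) (F : I -> 'X_{1..m}) :
  \prod_(i <- r | P i) fps_mono K (F i) = fps_mono K (\sum_(i <- r | P i) F i).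
Proof. by elim/big_rec2: _ => // i x y _ ->; rewrite fps_monoD. Qed.

Lemma fvar_prodX a : \prod_i fvar K i ^+ a i = fps_mono K a.
Proof.
rewrite (eq_bigr _ (fun i _ => fps_monoX U_(i) (a i))) fps_mono_prod.
by rewrite -multinomUE_id.
Qed.

Lemma fvarM i h a :
  (fvar K i * h) a = if (0 < a i)%N then h (a - U_(i))%MM else 0.
Proof. by rewrite fps_monoM lep1mP lt0n. Qed.

(** Weight of a monomial when the i-th variable has weight w i.  Taking w = 1 gives
the degree, so that one filtration serves both to handle truncations and to run
the weighted induction. *)
Definition mwt w a : nat := \sum_i a i * w i.

Lemma mwtD w a b : mwt w (a + b) = (mwt w a + mwt w b)%N.
Proof. by rewrite -big_split; apply: eq_bigr => i _; rewrite mnmDE mulnDl. Qed.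

Lemma mwt_mdeg a : mwt (fun=> 1%N) a = mdeg a.
Proof. by rewrite mdegE; apply: eq_bigr => i _; rewrite muln1. Qed.

Lemma mwt1 w i : mwt w U_(i) = w i.
Proof.
rewrite /mwt (bigD1 i) //= mnm1E eqxx mul1n big1 ?addn0 // => j ne_ji.
by rewrite mnm1E eq_sym (negbTE ne_ji).
Qed.

Lemma mdeg_mwt w a : (forall i, 0 < w i)%N -> (mdeg a <= mwt w a)%N.
Proof.
by move=> w0; rewrite mdegE; apply: leq_sum => i _; rewrite leq_pmulr.
Qed.

Definition wge w (s : nat) f := forall a, (mwt w a < s)%N -> f a = 0.

Lemma wge0 w s : wge w s 0. Proof. by []. Qed.
Lemma wgeW w s t f : (t <= s)%N -> wge w s f -> wge w t f.
Proof. by move=> le_ts ws a lt_a; apply/ws/(leq_trans lt_a). Qed.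

Lemma wgeD w s f g : wge w s f -> wge w s g -> wge w s (f + g).
Proof. by move=> wf wg a lt_a; rewrite fpsD wf ?wg ?addr0. Qed.

Lemma wgeN w s f : wge w s f -> wge w s (- f).
Proof. by move=> wf a lt_a; rewrite fpsN wf ?oppr0. Qed.

Lemma wgeB w s f g : wge w s f -> wge w s g -> wge w s (f - g).
Proof. by move=> wf wg; apply/wgeD/wgeN. Qed.

Lemma wgeZ w s k f : wge w s f -> wge w s (k *: f).
Proof. by move=> wf a lt_a; rewrite fpsZ wf ?mulr0. Qed.

Lemma wge_sum w s (I : Type) (r : seq I) (P : pred I) (F : I -> fps K m) :
  (forall i, P i -> wge w s (F i)) -> wge w s (\sum_(i <- r | P i) F i).
Proof.
by move=> wF; elim/big_rec: _ => [|i x Pi]; [exact: wge0|apply/wgeD/wF].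
Qed.

Lemma wgeM w s t f g : wge w s f -> wge w t g -> wge w (s + t) (f * g).
Proof.
move=> wf wg a lt_a; apply: big1 => -[k1 k2] /= /eqP ak.
have [lt1|le1] := ltnP (mwt w k1) s; first by rewrite wf ?mul0r.
rewrite wg ?mulr0 // -(ltn_add2l s); apply: leq_ltn_trans lt_a.
by rewrite [X in (_ <= mwt w X)%N]ak mwtD leq_add2r.
Qed.

Lemma wge1 w : wge w 0 1. Proof. by []. Qed.

Lemma wgeX w s f (p : nat) : wge w s f -> wge w (p * s) (f ^+ p).
Proof.
by move=> wf; elim: p => // p IH; rewrite exprS mulSn; apply: wgeM.
Qed.

Lemma wge_fvar w i : wge w (w i) (fvar K i).
Proof. by move=> a /=; case: eqP => // <-; rewrite mwt1 ltnn. Qed.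

End FpsBasics.

Section Composition.
Variables (K : comNzRingType) (p q : nat).
Implicit Types (F : fps K p) (G : 'I_p -> fps K q).

Definition mono_subst G (b : 'X_{1..p}) := \prod_i G i ^+ b i.

Lemma fcompE F G a :
  fcomp F G a = \sum_(b : 'X_{1..p < (mdeg a).+1}) F b * mono_subst G b a.
Proof. by []. Qed.

Lemma fcompD F1 F2 G : fcomp (F1 + F2) G = fcomp F1 G + fcomp F2 G.
Proof.
by apply: fpsP => a; rewrite fpsD -big_split; apply: eq_bigr => b _; rewrite mulrDl.
Qed.

Lemma fcompZ k F G : fcomp (k *: F) G = k *: fcomp F G.
Proof.
by apply: fpsP => a; rewrite fpsZ mulr_sumr; apply: eq_bigr => b _; rewrite mulrA.
Qed.

Lemma fcompN F G : fcomp (- F) G = - fcomp F G.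
Proof. by rewrite -scaleN1r fcompZ scaleN1r. Qed.

Lemma fcompB F1 F2 G : fcomp (F1 - F2) G = fcomp F1 G - fcomp F2 G.
Proof. by rewrite fcompD fcompN. Qed.

Lemma fcomp0 G : fcomp 0 G = 0.
Proof. by rewrite -(scale0r 0) fcompZ scale0r. Qed.

Lemma fcomp_sum (I : Type) (r : seq I) (P : pred I) (F : I -> fps K p) G :
  fcomp (\sum_(i <- r | P i) F i) G = \sum_(i <- r | P i) fcomp (F i) G.
Proof. by elim/big_rec2: _ => [|i x y _ <-]; rewrite ?fcomp0 ?fcompD. Qed.

Lemma wge_mono_subst (u : 'I_p -> nat) (w : 'I_q -> nat) G b :
  (forall i, wge w (u i) (G i)) -> wge w (mwt u b) (mono_subst G b).
Proof.
move=> wG; rewrite /mono_subst /mwt.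
by elim/big_rec2: _ => [|i x y _ IH]; [exact: wge1|apply: wgeM; first exact: wgeX].
Qed.

Lemma mono_subst_eq0 G b a : (forall i, fcst (G i) = 0) ->
  (mdeg a < mdeg b)%N -> mono_subst G b a = 0.
Proof.
move=> G0 lt_ab; apply: (@wge_mono_subst (fun=> 1%N) (fun=> 1%N)); last by rewrite !mwt_mdeg.
by move=> i c; rewrite mwt_mdeg ltnS leqn0 mdeg_eq0 => /eqP ->; exact: G0.
Qed.

(** A substitution without constant terms may be truncated at any degree beyond the
one that is read off.  A bound independent of the coefficient makes it possible to
add and factor such sums. *)
Lemma fcomp_bound F G d a : (forall i, fcst (G i) = 0) -> (mdeg a < d)%N ->
  fcomp F G a = \sum_(b : 'X_{1..p < d}) F b * mono_subst G b a.
Proof.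
move=> G0 lt_ad; rewrite fcompE [RHS](bigID (fun b : 'X_{1..p < d} => mdeg b < (mdeg a).+1)%N) /=.
rewrite [X in _ = _ + X]big1 ?addr0; last first.
  by move=> b; rewrite -leqNgt => lt_ab; rewrite mono_subst_eq0 ?mulr0.
have widen (b : 'X_{1..p < (mdeg a).+1}) : (mdeg b < d)%N by apply: leq_trans (bmdeg b) lt_ad.
pose narrow (b : 'X_{1..p < d}) : option 'X_{1..p < (mdeg a).+1} := insub (bmnm b).
rewrite [RHS](reindex_omap (fun b => BMultinom (widen b)) narrow) /narrow /=; last first.
  by move=> b lt_b; rewrite insubT /=; congr Some; apply: val_inj.
apply: eq_bigl => b; rewrite bmdeg /= insubT ?bmdeg // => lt_b.
by symmetry; apply/eqP; congr Some; apply: val_inj.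
Qed.

Lemma fcomp_mono b G : (forall i, fcst (G i) = 0) ->
  fcomp (fps_mono K b) G = mono_subst G b.
Proof.
move=> G0; apply: fpsP => a.
have lt_bd : (mdeg b < maxn (mdeg a).+1 (mdeg b).+1)%N by rewrite leq_maxr.
rewrite (@fcomp_bound _ _ (maxn (mdeg a).+1 (mdeg b).+1)) ?leq_maxl //.
rewrite (bigD1 (BMultinom lt_bd)) //= eqxx mul1r big1 ?addr0 // => c ne_cb.
case: eqP => [ebc|]; last by rewrite mul0r.
by case/eqP: ne_cb; apply: val_inj.
Qed.

Lemma fcomp_fvar i G : (forall i, fcst (G i) = 0) -> fcomp (fvar K i) G = G i.
Proof.
move=> G0; rewrite fcomp_mono // /mono_subst (bigD1 i) //= mnm1E eqxx expr1.
by rewrite big1 ?mulr1 // => j ne_ji; rewrite mnm1E eq_sym (negbTE ne_ji) expr0.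
Qed.

Lemma fcomp_fvarM i j G : (forall i, fcst (G i) = 0) ->
  fcomp (fvar K i * fvar K j) G = G i * G j.
Proof.
move=> G0; rewrite fps_monoD fcomp_mono // -(fcomp_fvar i G0) -(fcomp_fvar j G0).
rewrite !fcomp_mono // /mono_subst -big_split.
by apply: eq_bigr => k _; rewrite mnmDE exprD.
Qed.

Lemma fcomp_wge (u : 'I_p -> nat) (w : 'I_q -> nat) s F G :
  (forall i, wge w (u i) (G i)) -> wge u s F -> wge w s (fcomp F G).
Proof.
move=> wG wF a lt_a; rewrite fcompE big1 // => b _.
have [lt_b|le_b] := ltnP (mwt u b) s; first by rewrite wF ?mul0r.
by rewrite (@wge_mono_subst u w) ?mulr0 // (leq_trans lt_a).
Qed.

(** Replacing one variable of weight u i by something that differs from it at weight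
u i + e raises the weight of the difference by e, by the telescoping
x x' - y y' = (x - y) x' + y (x' - y'). *)
Lemma mono_subst_close (u : 'I_p -> nat) (w : 'I_q -> nat) e G G' b :
  (forall i, wge w (u i) (G i)) -> (forall i, wge w (u i) (G' i)) ->
  (forall i, wge w (u i + e) (G i - G' i)) ->
  wge w (mwt u b + e) (mono_subst G b - mono_subst G' b).
Proof.
move=> wG wG' wGG'.
suff [] : [/\ wge w (mwt u b) (mono_subst G b), wge w (mwt u b) (mono_subst G' b)
   & wge w (mwt u b + e) (mono_subst G b - mono_subst G' b)] by [].
pose close s (x y : fps K q) := [/\ wge w s x, wge w s y & wge w (s + e) (x - y)].
have closeM s t x y x' y' : close s x y -> close t x' y' -> close (s + t)%N (x * x') (y * y').
  move=> [wx wy wxy] [wx' wy' wxy']; split; [exact: wgeM|exact: wgeM|].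
  have -> : x * x' - y * y' = (x - y) * x' + y * (x' - y') by ring.
  by apply: wgeD; [rewrite addnAC|rewrite -addnA]; apply: wgeM.
have closeX i k : close (k * u i)%N (G i ^+ k) (G' i ^+ k).
  elim: k => [|k IH]; first by split; rewrite ?subrr.
  by rewrite mulSn !exprS; apply: closeM.
rewrite /mono_subst /mwt -/(close _ _ _).
by elim/big_rec3: _ => [|i s x y _ IH]; [split; rewrite ?subrr | apply: closeM].
Qed.

(** This is what makes A2 (H) - A2 negligible in the induction: H is close to the
identity up to the weight already reached. *)
Lemma fcomp_close (u : 'I_p -> nat) (w : 'I_q -> nat) s e F G G' :
  (forall i, wge w (u i) (G i)) -> (forall i, wge w (u i) (G' i)) ->
  (forall i, wge w (u i + e) (G i - G' i)) -> wge u s F ->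
  wge w (s + e) (fcomp F G - fcomp F G').
Proof.
move=> wG wG' wGG' wF a lt_a; rewrite fpsB !fcompE -sumrB big1 // => b _.
rewrite -mulrBr -fpsB.
have [lt_b|le_b] := ltnP (mwt u b) s; first by rewrite wF ?mul0r.
rewrite (@mono_subst_close u w e) ?mulr0 //.
by apply: leq_trans lt_a _; rewrite leq_add2r.
Qed.

Lemma mono_subst_congr G G' (x : fps K q) b :
  (forall i, exists y, G i - G' i = y * x) ->
  exists y, mono_subst G b - mono_subst G' b = y * x.
Proof.
move=> GG'; pose congx (g g' : fps K q) := exists y, g - g' = y * x.
have congM g1 g1' g2 g2' : congx g1 g1' -> congx g2 g2' -> congx (g1 * g2) (g1' * g2').
  move=> [y1 e1] [y2 e2]; exists (y1 * g2 + g1' * y2).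
  have -> : (y1 * g2 + g1' * y2) * x = y1 * x * g2 + g1' * (y2 * x) by ring.
  by rewrite -e1 -e2; ring.
have cong1 : congx 1 1 by exists 0; rewrite subrr mul0r.
rewrite /mono_subst -/(congx _ _); elim/big_rec2: _ => // i g g' _ IH.
by apply: (congM) => //; elim: (b i) => // k IHk; rewrite !exprS; apply: (congM).
Qed.

(** Congruence modulo the ideal generated by x.  The quotient is only produced up to
a given degree, which keeps it a finite sum. *)
Lemma fcomp_congr F G G' (x : fps K q) d :
  (forall i, fcst (G i) = 0) -> (forall i, fcst (G' i) = 0) ->
  (forall i, exists y, G i - G' i = y * x) ->
  exists y, forall a, (mdeg a < d)%N -> (fcomp F G - fcomp F G') a = (y * x) a.
Proof.
move=> G0 G'0 GG'.
have [y ye] := choice (fun b => mono_subst_congr b GG').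
exists (\sum_(b : 'X_{1..p < d}) F b *: y b) => a lt_ad.
rewrite fpsB !(fcomp_bound _ _ lt_ad) // -sumrB mulr_suml fps_sum.
by apply: eq_bigr => b _; rewrite -mulrBr -fpsB ye fps_scale_mull.
Qed.

End Composition.

Lemma fcomp_id (K : comNzRingType) (p : nat) (F : fps K p) :
  fcomp F (fun i => fvar K i) = F.
Proof.
apply: fpsP => a; rewrite fcompE (bigD1 (BMultinom (ltnSn (mdeg a)))) //=.
rewrite /mono_subst fvar_prodX /= eqxx mulr1 big1 ?addr0 // => b ne_b.
rewrite fvar_prodX /=; case: eqP => [eba|]; last by rewrite mulr0.
by case/eqP: ne_b; apply: val_inj.
Qed.

(** * The rank of a multiple of a nondegenerate form *)

Lemma mnm_addAC (n : nat) : right_commutative (@mnm_add n).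
Proof. by move=> a b c; apply/mnmP => i; rewrite !mnmDE addnAC. Qed.

Section FormRank.
Variables (K : fieldType) (n : nat) (eps : 'I_n -> K).
Hypothesis eps_neq0 : forall j, eps j != 0.
Implicit Types (q : 'X_{1..n} -> 'X_{1..n} -> K) (a b : 'X_{1..n}).

(** Coefficients of the product of q with the form sum_j eps_j z_j zbar_j. *)
Definition form_mul q a b : K :=
  \sum_j eps j * (if (0 < a j)%N && (0 < b j)%N
                  then q (a - U_(j))%MM (b - U_(j))%MM else 0).

Lemma form_mul_neq0 q a b : form_mul q a b != 0 ->
  exists j a' b', [/\ a = (a' + U_(j))%MM, b = (b' + U_(j))%MM & q a' b' != 0].
Proof.
move=> nz; have [j nzj] : exists j,
    (if (0 < a j)%N && (0 < b j)%N then q (a - U_(j))%MM (b - U_(j))%MM else 0) != 0.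
  apply/existsP; apply: contraNT nz => /existsPn z.
  by apply/eqP/big1 => j _; move/negPn/eqP: (z j) => ->; rewrite mulr0.
move: nzj; case: ifP => [/andP[a0 b0] nzj|_]; last by rewrite eqxx.
by exists j, (a - U_(j))%MM, (b - U_(j))%MM; rewrite !submK // lep1mP -lt0n.
Qed.

(** The matrix of a nonzero multiple of the form contains a triangular n x n block
with nonzero diagonal.  Among the monomials z^a zbar^b of q, consider those for
which a - b is maximal for the monomial order; multiplying by z_m zbar_m does not
change a - b, so these monomials evolve on their own.  In this family choose,
for each j, a monomial with the largest exponent of z_j: multiplied by z_j zbar_j,
it gives a monomial that no other summand of the form can produce.  The n monomials
so obtained are distinct, and below the diagonal a - b would exceed its maximum. *)
Lemma form_mul_staircase q mu nu :
  (forall a b, q a b != 0 -> mdeg a = mu /\ mdeg b = nu) ->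
  (exists a b, q a b != 0) ->
  exists a b : 'I_n -> 'X_{1..n},
    [/\ injective a, forall j, mdeg (a j) = mu.+1 /\ mdeg (b j) = nu.+1,
        forall j, form_mul q (a j) (b j) != 0
      & forall i j, (a j < a i)%O -> form_mul q (a i) (b j) = 0].
Proof.
move=> supp [a0 [b0 nz0]].
pose I : finType := ('X_{1..n < mu.+1} * 'X_{1..n < nu.+1})%type.
pose P (p : I) := q p.1 p.2 != 0.
have toI a b : q a b != 0 -> exists2 p : I, P p & p.1 = a :> 'X_{1..n} /\ p.2 = b :> 'X_{1..n}.
  move=> nz; have [da db] := supp _ _ nz.
  have la : (mdeg a < mu.+1)%N by rewrite da.
  have lb : (mdeg b < nu.+1)%N by rewrite db.
  by exists (BMultinom la, BMultinom lb).
have [p0 Pp0 _] := toI _ _ nz0.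
pose T : eqType := ('X_{1..n} * 'X_{1..n})%type.
(* p.1 - p.2 dominates p'.1 - p'.2, stated without negative exponents *)
pose ord : rel T := fun p p' => ((p'.1 + p.2)%MM <= (p.1 + p'.2)%MM)%O.
have ord_refl : reflexive ord by move=> p; rewrite /ord lexx.
have ord_total : total ord by move=> p p'; rewrite /ord le_total.
have ord_trans : transitive ord.
  move=> p2 p1 p3; rewrite /ord => le21 le32.
  rewrite -(lemc_add2l _ _ (p2.1 + p2.2)%MM).
  have := lem_add le21 le32; congr (_ <= _)%O; apply/mnmP => i; rewrite !mnmDE; lia.
pose F (p : I) : T := (bmnm p.1, bmnm p.2).
have [pm Ppm maxpm] := extremumP F ord_refl ord_trans ord_total Pp0.
pose am := bmnm pm.1; pose bm := bmnm pm.2.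
have max_q a b : q a b != 0 -> ((a + bm)%MM <= (am + b)%MM)%O.
  by case/toI => p Pp [<- <-]; exact: (maxpm p Pp).
pose D a b := (a + bm)%MM == (am + b)%MM.
have Dpm : D am bm by rewrite /D eqxx.
pose PD (p : I) := P p && D p.1 p.2.
have PDpm : PD pm by rewrite /PD Ppm.
have pick j : exists p : I, PD p /\ forall a b, q a b != 0 -> D a b -> (a j <= p.1 j)%N.
  have [p PDp maxp] := arg_maxnP (fun p : I => bmnm p.1 j) PDpm.
  exists p; split=> // a b /toI[p' Pp' [<- <-]] Dp'.
  by apply: maxp; rewrite /PD Pp'.
have [p pP] := choice pick.
pose a j := ((p j).1 + U_(j))%MM; pose b j := ((p j).2 + U_(j))%MM.
have degp j : mdeg (p j).1 = mu /\ mdeg (p j).2 = nu.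
  by have [/andP[/supp]] := pP j.
have Dp j : (a j + bm)%MM = (am + b j)%MM.
  have [/andP[_ /eqP e] _] := pP j.
  by rewrite /a /b mnm_addAC e addmA.
exists a, b; split.
- move=> i j eq_a; apply/eqP/negPn/negP => ne_ij.
  have [/andP[/= nz Dpj] _] := pP j; have [_ /(_ _ _ nz Dpj)] := pP i.
  have := congr1 (fun c : 'X_{1..n} => c i) eq_a.
  by rewrite /a !mnmDE !mnm1E eqxx eq_sym (negbTE ne_ij) addn0 addn1 => <-; rewrite ltnn.
- by move=> j; have [ea eb] := degp j; rewrite !mdegD !mdeg1 !addn1 ea eb.
- move=> j; rewrite /form_mul (bigD1 j) //= big1 ?addr0.
    rewrite /a /b !mnmDE !mnm1E eqxx !addn1 /= !addmK mulf_neq0 //.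
    by have [/andP[]] := pP j.
  move=> k ne_kj; case: ifP => [/andP[a0k b0k]|_]; last by rewrite mulr0.
  have ak : (U_(k) <= a j)%MM by rewrite lep1mP -lt0n.
  have bk : (U_(k) <= b j)%MM by rewrite lep1mP -lt0n.
  have [->|nz] := eqVneq (q (a j - U_(k))%MM (b j - U_(k))%MM) 0; first by rewrite mulr0.
  have [_ /(_ _ _ nz)] := pP j; rewrite mnmBE mnmDE !mnm1E eqxx (negbTE ne_kj).
  rewrite addn1 subn0 ltnn => abs; suff : false by []; apply: abs.
  rewrite /D -(eqm_add2r U_(k)%MM) [(a j - U_(k) + bm)%MM]addmC -!addmA !submK //.
  by rewrite addmC Dp.
- move=> i j lt_ji; apply/eqP/negPn/negP => /form_mul_neq0[k [a' [b' [ea eb /max_q]]]].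
  rewrite -(lemc_add2l _ _ U_(k)%MM) mnm_addAC -ea -addmA -eb -Dp lemc_add2l.
  by rewrite leNgt lt_ji.
Qed.

(** A linear relation between the columns b_j is refuted by reading it on the row of
the largest a_i that occurs in it. *)
Lemma staircase_rank (B : 'X_{1..n} -> 'X_{1..n} -> K) (a b : 'I_n -> 'X_{1..n})
    r (v : 'I_r -> 'X_{1..n} -> K) :
  injective a -> (forall j, B (a j) (b j) != 0) ->
  (forall i j, (a j < a i)%O -> B (a i) (b j) = 0) ->
  (forall j, exists c : 'I_r -> K, forall i, B (a i) (b j) = \sum_k c k * v k (a i)) ->
  (n <= r)%N.
Proof.
move=> inj_a diag tri span; rewrite leqNgt; apply/negP => lt_rn.
have [c cE] := choice span.
pose M : 'M_(n, r) := \matrix_(j, k) c j k.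
(* The n columns are combinations of r < n vectors, hence linearly dependent. *)
have : kermx M != 0.
  rewrite kermx_eq0; apply/negP => /eqP rkM.
  by have := rank_leq_col M; rewrite rkM leqNgt lt_rn.
rewrite -nz_row_eq0; set x := nz_row _ => x_neq0.
have xM : x *m M = 0 by apply/sub_kermxP; rewrite nz_row_sub.
have [i0 xi0] : exists i, x ord0 i != 0.
  apply/existsP; apply: contraNT x_neq0 => /existsPn z.
  by apply/eqP/rowP => i; rewrite mxE; move/negPn/eqP: (z i).
have [i xi max_i] := @Order.TotalTheory.arg_maxP _ _ _ i0 (fun i => x ord0 i != 0) a xi0.
have : \sum_j x ord0 j * B (a i) (b j) = 0.
  under eq_bigr do rewrite cE mulr_sumr.
  rewrite exchange_big big1 // => k _ /=.
  under eq_bigr do rewrite mulrA.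
  rewrite -mulr_suml; have /rowP/(_ k) := xM; rewrite !mxE => e.
  by under eq_bigr => j _ do rewrite -[c j k](mxE matrix_key (fun j k => c j k)); rewrite e mul0r.
rewrite (bigD1 i) //= big1 ?addr0 => [/eqP|j ne_ji].
  by rewrite mulf_eq0 (negbTE xi) (negbTE (diag i)).
have [->|xj] := eqVneq (x ord0 j) 0; first by rewrite mul0r.
rewrite tri ?mulr0 // lt_neqAle; apply/andP; split; last exact: max_i.
by apply: contraNneq ne_ji => /inj_a ->.
Qed.

(** Huang's lemma on nondegenerate forms.  The rank bound k1 + k2 < n enters the proof
only here. *)
Lemma form_mul_rank q mu nu r (v : 'I_r -> 'X_{1..n} -> K) :
  (forall a b, q a b != 0 -> mdeg a = mu /\ mdeg b = nu) -> (r < n)%N ->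
  (forall b, mdeg b = nu.+1 -> exists c : 'I_r -> K,
     forall a, mdeg a = mu.+1 -> form_mul q a b = \sum_k c k * v k a) ->
  forall a b, q a b = 0.
Proof.
move=> supp lt_rn span a b; apply/eqP/negPn/negP => nz.
have [a' [b' [inj_a deg diag tri]]] := form_mul_staircase supp (ex_intro _ a (ex_intro _ b nz)).
suff : (n <= r)%N by rewrite leqNgt lt_rn.
apply: (staircase_rank (v := v) inj_a diag tri) => j.
have [_ /span[c cE]] := deg j; exists c => i; apply: cE.
by have [] := deg i.
Qed.

End FormRank.

(** * The linearized equation, coefficient by coefficient *)

Section LinearRigidity.
Variables (C : numClosedFieldType) (n s : nat) (eps : 'I_n -> C).
Hypothesis eps_neq0 : forall j, eps j != 0.
Variables (F : 'I_n -> 'X_{1..n} -> nat -> C) (G : 'X_{1..n} -> nat -> C).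
Variables (A Q : 'X_{1..n} -> nat -> 'X_{1..n} -> nat -> C).
Implicit Types (a b : 'X_{1..n}) (ga de : nat).

(** Coefficient of z^a w^ga zbar^b wbar^de in the Chern-Moser operator, where F, G, A
are the coefficients of f, g and A2 - A1.  The four summands live on
disjoint sets of monomials once the low order terms are removed. *)
Definition cm_coef a ga b de : C :=
  (if (b == 0%MM) && (de == 0%N) then G a ga else 0)
  - (if (a == 0%MM) && (ga == 0%N) then (G b de)^* else 0)
  - 2 * 'i * (\sum_j eps j *
      ((if (b == U_(j)%MM) && (de == 0%N) then F j a ga else 0)
       + (if (a == U_(j)%MM) && (ga == 0%N) then (F j b de)^* else 0)))
  - 2 * 'i * A a ga b de.

(** The same coefficient in Q sigma, with sigma = w - wbar - 2i <z, zbar>. *)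
Definition sigma_coef a ga b de : C :=
  (if (0 < ga)%N then Q a ga.-1 b de else 0)
  - (if (0 < de)%N then Q a ga b de.-1 else 0)
  - 2 * 'i * form_mul eps (fun a b => Q a ga b de) a b.

Hypothesis F_low : forall j a ga, (mdeg a + ga <= 1)%N -> F j a ga = 0.
Hypothesis G_low : forall a ga, (mdeg a + ga <= 1)%N -> G a ga = 0.
Hypothesis G_re : 'Re (G 0%MM 2%N) = 0.
Hypothesis A_lowl : forall a ga b de, (mdeg a + ga <= 1)%N -> A a ga b de = 0.
Hypothesis A_lowr : forall a ga b de, (mdeg b + de <= 1)%N -> A a ga b de = 0.
Hypothesis A_rank : forall mu ga nu de, exists r (v : 'I_r -> 'X_{1..n} -> C),
  (r < n)%N /\ forall b, mdeg b = nu -> exists c : 'I_r -> C,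
    forall a, mdeg a = mu -> A a ga b de = \sum_k c k * v k a.
Hypothesis eq_s : forall a ga b de, (mdeg a + ga.*2 + mdeg b + de.*2)%N = s ->
  cm_coef a ga b de = sigma_coef a ga b de.

Lemma twoi_neq0 : 2 * 'i != 0 :> C.
Proof. by rewrite mulf_neq0 ?neq0Ci // pnatr_eq0. Qed.

Lemma mdeg_gt0_neq0 a : (0 < mdeg a)%N -> (a == 0%MM) = false.
Proof. by move=> a0; rewrite -mdeg_eq0 eqn0Ngt a0. Qed.

Lemma form_mul0l q b : form_mul eps q 0%MM b = 0.
Proof. by apply: big1 => j _; rewrite mnm0E mulr0. Qed.

Lemma form_mul0r q a : form_mul eps q a 0%MM = 0.
Proof. by apply: big1 => j _; rewrite mnm0E andbF mulr0. Qed.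

(** Induction on ga + de: in the equation at z-degree |a| + 1 and zbar-degree |b| + 1,
the two terms that shift w and wbar concern smaller ga + de, and neither f nor g
contributes to it, so the component of A equals the form times a component of Q. *)
Lemma sigma_factor_mixed a ga b de : (mdeg a + ga.*2 + mdeg b + de.*2 + 2)%N = s ->
  (0 < mdeg a + ga)%N -> (0 < mdeg b + de)%N -> Q a ga b de = 0.
Proof.
have [k] := ubnP (ga + de)%N; elim: k a ga b de => // k IH a ga b de.
rewrite ltnS => le_k deg_s pos_a pos_b.
pose mu := mdeg a; pose nu := mdeg b.
(* Only one bidegree of Q is used, so that the support is finite. *)
pose q a b := if (mdeg a == mu) && (mdeg b == nu) then Q a ga b de else 0.
have qab : q a b = Q a ga b de by rewrite /q !eqxx.
have [r [v [lt_rn vP]]] := A_rank mu.+1 ga nu.+1 de.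
rewrite -qab; apply: (@form_mul_rank _ _ _ eps_neq0 q mu nu r v) => // [a1 b1|b1 db1].
  by rewrite /q; case: ifP => [/andP[/eqP-> /eqP->]|]; rewrite ?eqxx.
have [c cE] := vP b1 db1; exists c => a1 da1; rewrite -cE //.
have -> : form_mul eps q a1 b1 = form_mul eps (fun a b => Q a ga b de) a1 b1.
  apply: eq_bigr => j _; case: ifP => // /andP[a1j b1j]; congr (_ * _).
  rewrite /q -(eqn_add2r 1) -{1}(mdeg1 j) -mdegD submK ?lep1mP -?lt0n // da1 addn1 eqxx.
  by rewrite -(eqn_add2r 1) -{1}(mdeg1 j) -mdegD submK ?lep1mP -?lt0n // db1 addn1 eqxx.
have : cm_coef a1 ga b1 de = sigma_coef a1 ga b1 de.
  by apply: eq_s; rewrite da1 db1 -deg_s /mu /nu; lia.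
rewrite /cm_coef /sigma_coef !mdeg_gt0_neq0 ?da1 ?db1 //= subrr sub0r.
rewrite big1 => [|j _]; last first.
  case: (boolP (_ && (de == 0%N))) => [/andP[/eqP eb /eqP ed]|_].
    by move: db1 pos_b; rewrite eb mdeg1 ed /nu; lia.
  case: (boolP (_ && (ga == 0%N))) => [/andP[/eqP ea /eqP eg]|_].
    by move: da1 pos_a; rewrite ea mdeg1 eg /mu; lia.
  by rewrite addr0 mulr0.
rewrite mulr0 oppr0 add0r.
have -> : (if (0 < ga)%N then Q a1 ga.-1 b1 de else 0) = 0.
  by case: ifP => // ga0; apply: IH; rewrite ?da1 ?db1 -?deg_s ?/mu ?/nu //; lia.
have -> : (if (0 < de)%N then Q a1 ga b1 de.-1 else 0) = 0.
  by case: ifP => // de0; apply: IH; rewrite ?da1 ?db1 -?deg_s ?/mu ?/nu //; lia.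
by rewrite subrr sub0r => /oppr_inj /(mulfI twoi_neq0).
Qed.

Lemma cm_coef_mixed0 a ga : (0 < mdeg a + ga)%N ->
  cm_coef a ga 0%MM 1 = 0.
Proof.
move=> pos_a; rewrite /cm_coef andbF.
have -> : (a == 0%MM) && (ga == 0%N) = false.
  by rewrite -mdeg_eq0 -addn_eq0 eqn0Ngt pos_a.
rewrite A_lowr ?mdeg0 // mulr0 !subr0 sub0r big1 ?mulr0 ?oppr0 // => j _.
by rewrite andbF F_low ?mdeg0 // rmorph0 if_same addr0 mulr0.
Qed.

Lemma cm_coef_mixed0' b de : (0 < mdeg b + de)%N ->
  cm_coef 0%MM 1 b de = 0.
Proof.
move=> pos_b; rewrite /cm_coef andbF.
have -> : (b == 0%MM) && (de == 0%N) = false.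
  by rewrite -mdeg_eq0 -addn_eq0 eqn0Ngt pos_b.
rewrite A_lowl ?mdeg0 // mulr0 !subr0 sub0r big1 ?mulr0 ?oppr0 // => j _.
by rewrite andbF F_low ?mdeg0 // if_same addr0 mulr0.
Qed.

(** The equation at wbar-degree 1 and zbar-degree 0, where the left-hand side is zero,
expresses the holomorphic part of Q by its mixed part.  The exception is the
coefficient of w, which is tied to that of wbar. *)
Lemma sigma_factor_holo a ga : (mdeg a + ga.*2 + 2)%N = s ->
  (0 < mdeg a + ga)%N -> (mdeg a, ga) != (0, 1)%N -> Q a ga 0%MM 0 = 0.
Proof.
move=> deg_s pos_a ne01.
have : cm_coef a ga 0%MM 1 = sigma_coef a ga 0%MM 1.
  by apply: eq_s; rewrite mdeg0 -deg_s; lia.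
rewrite cm_coef_mixed0 // /sigma_coef form_mul0r mulr0 subr0 /=.
have -> : (if (0 < ga)%N then Q a ga.-1 0%MM 1 else 0) = 0.
  case: ifP => // ga0; apply: sigma_factor_mixed; rewrite ?mdeg0 //; first lia.
  by move: ne01; rewrite xpair_eqE; lia.
by rewrite sub0r => /esym/eqP; rewrite oppr_eq0 => /eqP.
Qed.

Lemma sigma_factor_antiholo b de : (mdeg b + de.*2 + 2)%N = s ->
  (0 < mdeg b + de)%N -> (mdeg b, de) != (0, 1)%N -> Q 0%MM 0 b de = 0.
Proof.
move=> deg_s pos_b ne01.
have : cm_coef 0%MM 1 b de = sigma_coef 0%MM 1 b de.
  by apply: eq_s; rewrite mdeg0 -deg_s; lia.
rewrite cm_coef_mixed0' // /sigma_coef form_mul0l mulr0 subr0 /=.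
have -> : (if (0 < de)%N then Q 0%MM 1 b de.-1 else 0) = 0.
  case: ifP => // de0; apply: sigma_factor_mixed; rewrite ?mdeg0 //; first lia.
  by move: ne01; rewrite xpair_eqE; lia.
by rewrite subr0.
Qed.

Lemma cm_coef_holo a ga : (0 < mdeg a + ga)%N -> cm_coef a ga 0%MM 0 = G a ga.
Proof.
move=> pos_a; rewrite /cm_coef !eqxx /=.
have -> : (a == 0%MM) && (ga == 0%N) = false.
  by rewrite -mdeg_eq0 -addn_eq0 eqn0Ngt pos_a.
rewrite A_lowr ?mdeg0 // mulr0 !subr0 big1 ?mulr0 ?subr0 // => j _.
by rewrite [0%MM == _]eq_sym mnm1_eq0 add0r F_low ?mdeg0 // rmorph0 if_same mulr0.
Qed.

Lemma cm_coef_antiholo b de : (0 < mdeg b + de)%N ->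
  cm_coef 0%MM 0 b de = - (G b de)^*.
Proof.
move=> pos_b; rewrite /cm_coef !eqxx /=.
have -> : (b == 0%MM) && (de == 0%N) = false.
  by rewrite -mdeg_eq0 -addn_eq0 eqn0Ngt pos_b.
rewrite A_lowl ?mdeg0 // mulr0 sub0r big1 ?mulr0 ?subr0 // => j _.
by rewrite [0%MM == _]eq_sym mnm1_eq0 addr0 F_low ?mdeg0 // if_same mulr0.
Qed.

(** The two coefficients are equal to some r, and the equations at w^2 and at wbar^2
make r equal to g_ww / 2 and to its conjugate; so r is real, while the
normalization says that its real part vanishes. *)
Lemma sigma_factor_w : s = 4 -> Q 0%MM 1 0%MM 0 = 0 /\ Q 0%MM 0 0%MM 1 = 0.
Proof.
move=> s4.
have : cm_coef 0%MM 1 0%MM 1 = sigma_coef 0%MM 1 0%MM 1.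
  by apply: eq_s; rewrite mdeg0 s4.
rewrite cm_coef_mixed0 ?mdeg0 // /sigma_coef form_mul0r mulr0 subr0 /= => /esym/eqP.
rewrite subr_eq0 => /eqP q01.
have : cm_coef 0%MM 2 0%MM 0 = sigma_coef 0%MM 2 0%MM 0.
  by apply: eq_s; rewrite mdeg0 s4.
rewrite cm_coef_holo ?mdeg0 // /sigma_coef form_mul0r mulr0 !subr0 /= => g2.
have : cm_coef 0%MM 0 0%MM 2 = sigma_coef 0%MM 0 0%MM 2.
  by apply: eq_s; rewrite mdeg0 s4.
rewrite cm_coef_antiholo ?mdeg0 // /sigma_coef form_mul0r mulr0 subr0 sub0r /=.
move=> /oppr_inj g2'.
have g0 : G 0%MM 2%N = 0.
  move: G_re; rewrite ReE g2' q01 -g2 => /eqP.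
  by rewrite mulf_eq0 invr_eq0 pnatr_eq0 orbF -mulr2n mulrn_eq0 => /eqP.
by rewrite q01 -g2 g0.
Qed.

Lemma sigma_factor_cst : s = 2 -> Q 0%MM 0 0%MM 0 = 0.
Proof.
move=> s2.
have : cm_coef 0%MM 1 0%MM 0 = sigma_coef 0%MM 1 0%MM 0.
  by apply: eq_s; rewrite mdeg0 s2.
rewrite cm_coef_holo ?mdeg0 // G_low ?mdeg0 //.
by rewrite /sigma_coef form_mul0r mulr0 !subr0.
Qed.

Lemma sigma_factor_eq0 a ga b de :
  (mdeg a + ga.*2 + mdeg b + de.*2 + 2)%N = s -> Q a ga b de = 0.
Proof.
move=> deg_s.
have [a0|pos_a] := posnP (mdeg a + ga); last first.
  have [b0|pos_b] := posnP (mdeg b + de); last exact: sigma_factor_mixed.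
  have [/eqP] : mdeg b = 0%N /\ de = 0%N by lia.
  rewrite mdeg_eq0 => /eqP bz dz; rewrite dz.
  have [[/eqP az gz]|ne01] := eqVneq (mdeg a, ga) (0, 1)%N.
    move: az; rewrite mdeg_eq0 => /eqP az; rewrite az bz gz.
    by have [] := sigma_factor_w _; rewrite // -deg_s az bz gz dz mdeg0.
  by rewrite bz sigma_factor_holo //; move: deg_s; rewrite bz dz mdeg0; lia.
have [/eqP] : mdeg a = 0%N /\ ga = 0%N by lia.
rewrite mdeg_eq0 => /eqP az gz.
have [b0|pos_b] := posnP (mdeg b + de).
  have [/eqP] : mdeg b = 0%N /\ de = 0%N by lia.
  rewrite mdeg_eq0 => /eqP bz dz; rewrite az bz gz dz.
  by apply: sigma_factor_cst; rewrite -deg_s az bz gz dz mdeg0.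
have [[/eqP bz dz]|ne01] := eqVneq (mdeg b, de) (0, 1)%N.
  move: bz; rewrite mdeg_eq0 => /eqP bz; rewrite az bz gz dz.
  by have [] := sigma_factor_w _; rewrite // -deg_s az bz gz dz mdeg0.
by rewrite az gz sigma_factor_antiholo //; move: deg_s; rewrite az gz mdeg0; lia.
Qed.

Lemma cm_coef_eq0 a ga b de :
  (mdeg a + ga.*2 + mdeg b + de.*2)%N = s -> cm_coef a ga b de = 0.
Proof.
move=> deg_s; rewrite eq_s // /sigma_coef.
have -> : (if (0 < ga)%N then Q a ga.-1 b de else 0) = 0.
  by case: ifP => // ga0; apply: sigma_factor_eq0; lia.
have -> : (if (0 < de)%N then Q a ga b de.-1 else 0) = 0.
  by case: ifP => // de0; apply: sigma_factor_eq0; lia.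
rewrite subrr sub0r /form_mul big1 ?mulr0 ?oppr0 // => j _.
case: ifP => [/andP[aj bj]|_]; last by rewrite mulr0.
rewrite sigma_factor_eq0 ?mulr0 // -deg_s.
rewrite -[X in (_ = mdeg X + _ + _ + _)%N](submK (_ : U_(j) <= a)%MM) ?lep1mP -?lt0n //.
rewrite -[X in (_ = _ + mdeg X + _)%N](submK (_ : U_(j) <= b)%MM) ?lep1mP -?lt0n //.
by rewrite !mdegD !mdeg1; lia.
Qed.

Theorem linear_rigidity :
  [/\ forall j a ga, (mdeg a + ga.*2 + 1)%N = s -> F j a ga = 0,
      forall a ga, (mdeg a + ga.*2)%N = s -> G a ga = 0,
      forall a ga b de, (mdeg a + ga.*2 + mdeg b + de.*2)%N = s -> A a ga b de = 0
    & forall a ga b de, (mdeg a + ga.*2 + mdeg b + de.*2 + 2)%N = s ->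
        Q a ga b de = 0].
Proof.
split; last exact: sigma_factor_eq0.
- move=> j a ga deg_s; have [/F_low//|gt1] := leqP (mdeg a + ga) 1.
  have : cm_coef a ga U_(j)%MM 0 = 0 by apply: cm_coef_eq0; rewrite mdeg1 addn0.
  rewrite /cm_coef mnm1_eq0 /= A_lowr ?mdeg1 // mulr0 subr0.
  have -> : (a == 0%MM) && (ga == 0%N) = false.
    by rewrite -mdeg_eq0 -addn_eq0 eqn0Ngt; apply/negbTE; rewrite negbK; lia.
  rewrite subrr sub0r => /eqP; rewrite oppr_eq0 mulf_eq0 (negbTE twoi_neq0) /=.
  rewrite (bigD1 j) //= eqxx /= big1 ?addr0 => [|i ne_ij]; last first.
    rewrite eq_mnm1 eq_sym (negbTE ne_ij) /= F_low ?mdeg1 // rmorph0 if_same.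
    by rewrite addr0 mulr0.
  rewrite [F j U_(j)%MM _]F_low ?mdeg1 // rmorph0 if_same addr0 mulf_eq0.
  by rewrite (negbTE (eps_neq0 j)) => /eqP.
- move=> a ga deg_s; have [/G_low//|gt1] := leqP (mdeg a + ga) 1.
  by rewrite -cm_coef_holo ?cm_coef_eq0 ?mdeg0 ?addn0 //; lia.
- move=> a ga b de deg_s.
  have [/A_lowl//|gt1a] := leqP (mdeg a + ga) 1.
  have [/A_lowr//|gt1b] := leqP (mdeg b + de) 1.
  have := cm_coef_eq0 deg_s; rewrite /cm_coef.
  have -> : (a == 0%MM) && (ga == 0%N) = false by rewrite -mdeg_eq0; lia.
  have -> : (b == 0%MM) && (de == 0%N) = false by rewrite -mdeg_eq0; lia.
  rewrite subrr big1 ?mulr0 ?subr0 ?sub0r => [/eqP|j _].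
    by rewrite oppr_eq0 mulf_eq0 (negbTE twoi_neq0) => /eqP.
  have -> : (a == U_(j)%MM) && (ga == 0%N) = false.
    by apply: contraTF gt1a => /andP[/eqP -> /eqP ->]; rewrite mdeg1.
  have -> : (b == U_(j)%MM) && (de == 0%N) = false.
    by apply: contraTF gt1b => /andP[/eqP -> /eqP ->]; rewrite mdeg1.
  by rewrite addr0 mulr0.
Qed.

End LinearRigidity.

(** * Series in conjugate pairs of variables *)

Section Mcat.
Variables (p q : nat).
Implicit Types (a : 'X_{1..p}) (b : 'X_{1..q}) (c : 'X_{1..p + q}).

Lemma cat_fun_l (T : Type) (u : 'I_p -> T) (v : 'I_q -> T) i :
  cat_fun u v (lshift q i) = u i.
Proof. by rewrite /cat_fun -[lshift q i]/(unsplit (inl i)) unsplitK. Qed.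

Lemma cat_fun_r (T : Type) (u : 'I_p -> T) (v : 'I_q -> T) i :
  cat_fun u v (rshift p i) = v i.
Proof. by rewrite /cat_fun -[rshift p i]/(unsplit (inr i)) unsplitK. Qed.

Lemma cat_fun_ind (T : Type) (P : 'I_(p + q) -> T -> Prop) u v :
  (forall i, P (lshift q i) (u i)) -> (forall i, P (rshift p i) (v i)) ->
  forall i, P i (cat_fun u v i).
Proof. by move=> Pu Pv i; rewrite /cat_fun; case: split_ordP => j ->. Qed.

Lemma mcat_l a b i : mcat a b (lshift q i) = a i.
Proof. by rewrite mnmE cat_fun_l. Qed.

Lemma mcat_r a b i : mcat a b (rshift p i) = b i.
Proof. by rewrite mnmE cat_fun_r. Qed.

Lemma mleft_mcat a b : mleft (mcat a b) = a.
Proof. by apply/mnmP => i; rewrite mnmE mcat_l. Qed.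

Lemma mright_mcat a b : mright (mcat a b) = b.
Proof. by apply/mnmP => i; rewrite mnmE mcat_r. Qed.

Lemma mcat_mleftK c : mcat (mleft c) (mright c) = c.
Proof.
by apply/mnmP => i; case: (split_ordP i) => j ->; rewrite ?mcat_l ?mcat_r mnmE.
Qed.

Lemma mcat_inj a b a' b' : mcat a b = mcat a' b' -> a = a' /\ b = b'.
Proof. by move=> e; rewrite -(mleft_mcat a b) -{2}(mright_mcat a b) e mleft_mcat mright_mcat. Qed.

Lemma mcatD a b a' b' : (mcat a b + mcat a' b')%MM = mcat (a + a') (b + b').
Proof.
by apply/mnmP => i; case: (split_ordP i) => j ->; rewrite mnmDE ?mcat_l ?mcat_r mnmDE.
Qed.

Lemma mcatB a b a' b' : (mcat a b - mcat a' b')%MM = mcat (a - a') (b - b').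
Proof.
by apply/mnmP => i; case: (split_ordP i) => j ->; rewrite mnmBE ?mcat_l ?mcat_r mnmBE.
Qed.

Lemma mcat_eq0 a b : (mcat a b == 0%MM) = (a == 0%MM) && (b == 0%MM).
Proof.
rewrite -!mdeg_eq0 !mdegE big_split_ord /= addn_eq0.
by congr (_ && _); congr (_ == _); apply: eq_bigr => i _; rewrite ?mcat_l ?mcat_r.
Qed.

Lemma mwt_mcat w w' a b : mwt (cat_fun w w') (mcat a b) = (mwt w a + mwt w' b)%N.
Proof.
rewrite /mwt big_split_ord /=; congr (_ + _)%N; apply: eq_bigr => i _.
  by rewrite mcat_l cat_fun_l.
by rewrite mcat_r cat_fun_r.
Qed.

Lemma mdeg_mcat a b : mdeg (mcat a b) = (mdeg a + mdeg b)%N.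
Proof.
rewrite !mdegE big_split_ord /=.
by congr (_ + _)%N; apply: eq_bigr => i _; rewrite ?mcat_l ?mcat_r.
Qed.

Lemma mnm1_l (i : 'I_p) : U_(lshift q i)%MM = mcat U_(i)%MM 0%MM.
Proof.
by apply/mnmP => k; case: (split_ordP k) => j ->; rewrite ?mcat_l ?mcat_r !mnmE ?eq_lshift ?eq_lrshift.
Qed.

Lemma mnm1_r (i : 'I_q) : U_(rshift p i)%MM = mcat 0%MM U_(i)%MM.
Proof.
by apply/mnmP => k; case: (split_ordP k) => j ->; rewrite ?mcat_l ?mcat_r !mnmE ?eq_rshift ?eq_rlshift.
Qed.

Lemma mono_subst_cat (K : comNzRingType) (r : nat) (u : 'I_p -> fps K r)
    (v : 'I_q -> fps K r) a b :
  mono_subst (cat_fun u v) (mcat a b) = mono_subst u a * mono_subst v b.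
Proof.
rewrite /mono_subst big_split_ord /=; congr (_ * _); apply: eq_bigr => i _.
  by rewrite cat_fun_l mcat_l.
by rewrite cat_fun_r mcat_r.
Qed.

Lemma mono_subst_l (K : comNzRingType) a :
  mono_subst (fun i => fvar K (lshift q i)) a = fps_mono K (mcat a 0%MM).
Proof.
rewrite -(fvar_prodX K (mcat a (0%MM : 'X_{1..q}))) /mono_subst big_split_ord /= [X in _ = _ * X]big1.
  by rewrite mulr1; apply: eq_bigr => i _; rewrite mcat_l.
by move=> i _; rewrite mcat_r mnm0E.
Qed.

End Mcat.

Lemma mono_subst0 (K : comNzRingType) (p r : nat) (a : 'X_{1..p}) :
  mono_subst (fun=> 0 : fps K r) a = (a == 0%MM)%:R.
Proof.
have [->|a0] := eqVneq a 0%MM; first by rewrite /mono_subst big1 // => i _; rewrite mnm0E.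
have [i ai] : exists i, a i != 0%N.
  apply/existsP; apply: contraNT a0 => /existsPn z; apply/eqP/mnmP => i.
  by rewrite mnm0E; move/negPn/eqP: (z i).
by rewrite /mono_subst (bigD1 i) //= expr0n (negbTE ai) mul0r.
Qed.

Section HermitianCoefs.
Variables (C : numClosedFieldType) (m : nat).
Implicit Types (h : fps C m) (B : fps C (m + m)) (a b : 'X_{1..m}).

Lemma holoE h a b : holo h (mcat a b) = if b == 0%MM then h a else 0.
Proof.
rewrite /holo fcompE; have [->|b0] := eqVneq b 0%MM; last first.
  apply: big1 => c _; rewrite mono_subst_l /=; case: eqP => [/mcat_inj[_ e]|]; last by rewrite mulr0.
  by rewrite -e eqxx in b0.
have lt_a : (mdeg a < (mdeg (mcat a (0%MM : 'X_{1..m}))).+1)%N.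
  by rewrite ltnS mdeg_mcat leq_addr.
rewrite (bigD1 (BMultinom lt_a)) //= mono_subst_l /= eqxx mulr1.
rewrite big1 ?addr0 // => c ne_c; rewrite mono_subst_l /=.
case: eqP => [/mcat_inj[e _]|]; last by rewrite mulr0.
by case/eqP: ne_c; apply: val_inj.
Qed.

Lemma fbarE B a b : fbar B (mcat a b) = (B (mcat b a))^*.
Proof. by rewrite /= mleft_mcat mright_mcat. Qed.

Lemma fbarD B B' : fbar (B + B') = fbar B + fbar B'.
Proof. by apply: fpsP => c; rewrite /= rmorphD. Qed.

Lemma fbar_fvar i : fbar (fvar C (lshift m i)) = fvar C (rshift m i).
Proof.
apply: fpsP => c; rewrite -(mcat_mleftK c) fbarE /= mnm1_l mnm1_r.
rewrite rmorph_nat; congr (_%:R); congr nat_of_bool.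
by apply/eqP/eqP => /mcat_inj[-> ->].
Qed.

Lemma holoD h h' : holo (h + h') = holo h + holo h'.
Proof. exact: fcompD. Qed.

Lemma holo_fvar i : holo (fvar C i) = fvar C (lshift m i).
Proof. by rewrite /holo fcomp_fvar // => j; rewrite /fcst /= mnm1_eq0. Qed.

Lemma at_Zbar0E B a : at_Zbar0 B a = B (mcat a 0%MM).
Proof.
have lt_a : (mdeg (mcat a (0%MM : 'X_{1..m})) < (mdeg a).+1)%N.
  by rewrite mdeg_mcat mdeg0 addn0.
rewrite /at_Zbar0 fcompE (bigD1 (BMultinom lt_a)) //=.
have mE c : mono_subst (cat_fun (fun i => fvar C i) (fun=> 0)) c a
    = (c == mcat a 0%MM)%:R.
  rewrite -{1}(mcat_mleftK c) mono_subst_cat mono_subst0.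
  rewrite [mono_subst _ (mleft c)]fvar_prodX mulrC mulr_natl.
  rewrite -{3}(mcat_mleftK c); have [e|ne] := eqVneq (mright c) 0%MM.
    rewrite e mulr1n /=; congr ((nat_of_bool _)%:R).
    by apply/eqP/eqP => [->//|/mcat_inj[]].
  rewrite mulr0n; case: eqP => [/mcat_inj[_ e]|//].
  by rewrite e eqxx in ne.
rewrite mE eqxx mulr1 big1 ?addr0 // => c ne_c; rewrite mE.
by rewrite (_ : (_ == _) = false) ?mulr0 //; apply: contraNF ne_c => /eqP e; apply/eqP/val_inj.
Qed.

Lemma fderivm_bar B a b :
  at_Zbar0 (fderivm (mcat 0%MM b) B) a = B (mcat a b) *+ \prod_i (b i)`!.
Proof.
rewrite at_Zbar0E /= mcatD add0m addm0; congr (_ *+ _).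
rewrite big_split_ord /= big1 ?mul1n => [|i _]; last by rewrite !mcat_l mnm0E ffactn0.
by apply: eq_bigr => i _; rewrite !mcat_r ffactnn.
Qed.

(** The columns of the coefficient matrix are the derivatives at Zbar = 0 divided by
factorials, so a basis of the span of the derivatives generates them. *)
Lemma rank_leP B k : rank_le B k -> exists r (v : 'I_r -> 'X_{1..m} -> C),
  (r <= k)%N /\ forall b, exists c : 'I_r -> C,
    forall a, B (mcat a b) = \sum_i c i * v i a.
Proof.
case=> r le_rk [v [_ _ span]]; exists r, (fun i => fcoef (v i : fps C m)); split=> // b.
have [|c cE] := span (at_Zbar0 (fderivm (mcat 0%MM b) B)).
  by exists 1%N, (fun=> b), (fun=> 1); rewrite big_ord1 scale1r.
pose N := (\prod_i (b i)`!)%N.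
have N0 : N%:R != 0 :> C.
  by rewrite pnatr_eq0 -lt0n prodn_gt0 // => i; rewrite fact_gt0.
exists (fun i => N%:R^-1 * c i) => a; under eq_bigr do rewrite -mulrA.
rewrite -mulr_sumr; apply: (mulfI N0); rewrite mulVKf //.
have /(congr1 (fun h : fps C m => h a)) := cE; rewrite fderivm_bar fps_sum => e.
by rewrite mulr_natl -/N e; apply: eq_bigr.
Qed.

End HermitianCoefs.

(** * The linearized equation for series *)

Section Coordinates.
Variables (C : numClosedFieldType) (n : nat).
Local Notation N := (n + 1)%N.
Implicit Types (a b : 'X_{1..n}) (ga de : nat) (h : fps C (N + N)).

Definition idx1 a ga : 'X_{1..N} := mcat a [multinom ga | i < 1].
(** Every multi-index in (z, w, zbar, wbar) has this form; it turns series into the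
four-argument coefficient functions of the linear problem. *)
Definition idx a ga b de : 'X_{1..N + N} := mcat (idx1 a ga) (idx1 b de).

Definition wt1 : 'I_N -> nat := cat_fun (fun=> 1%N) (fun=> 2%N).
Definition wt2 : 'I_(N + N) -> nat := cat_fun wt1 wt1.

Lemma idx1_surj (c : 'X_{1..N}) : exists a ga, c = idx1 a ga.
Proof.
exists (mleft c), (mright c ord0); rewrite -[LHS]mcat_mleftK /idx1; congr mcat.
by apply/mnmP => i; rewrite [RHS]mnmE (ord1 i).
Qed.

Lemma idx_surj (c : 'X_{1..N + N}) : exists a ga b de, c = idx a ga b de.
Proof.
have [a [ga ea]] := idx1_surj (mleft c); have [b [de eb]] := idx1_surj (mright c).
by exists a, ga, b, de; rewrite -[LHS]mcat_mleftK ea eb.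
Qed.

Lemma idx1_00 : idx1 0%MM 0 = 0%MM.
Proof.
apply/eqP; rewrite mcat_eq0 eqxx /=; apply/eqP/mnmP => i.
by rewrite !mnmE.
Qed.

Lemma idx1_eq0 a ga : (idx1 a ga == 0%MM) = (a == 0%MM) && (ga == 0%N).
Proof.
by rewrite -idx1_00; apply/eqP/andP => [/mcat_inj[-> /mnmP/(_ ord0)]|[/eqP-> /eqP->//]]; rewrite !mnmE => ->.
Qed.

Lemma mwt_idx1 a ga : mwt wt1 (idx1 a ga) = (mdeg a + ga.*2)%N.
Proof. by rewrite mwt_mcat mwt_mdeg /mwt big_ord1 mnmE muln2. Qed.

Lemma mdeg_idx1 a ga : mdeg (idx1 a ga) = (mdeg a + ga)%N.
Proof. by rewrite mdeg_mcat [X in (_ + X)%N]mdegE big_ord1 mnmE. Qed.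

Lemma mwt_idx a ga b de :
  mwt wt2 (idx a ga b de) = (mdeg a + ga.*2 + mdeg b + de.*2)%N.
Proof. by rewrite mwt_mcat !mwt_idx1 addnA. Qed.

Lemma wt1_gt0 i : (0 < wt1 i)%N.
Proof. by apply: (cat_fun_ind (P := fun _ x => 0 < x)%N). Qed.

Lemma wt2_gt0 i : (0 < wt2 i)%N.
Proof. by apply: (cat_fun_ind (P := fun _ x => 0 < x)%N) => j; exact: wt1_gt0. Qed.

Lemma vz_coef j h a ga b de : (vz C j * h) (idx a ga b de)
  = if (0 < a j)%N then h (idx (a - U_(j)) ga b de) else 0.
Proof.
rewrite fvarM mcat_l mcat_l mnm1_l mnm1_l !mcatB !subm0.
by [].
Qed.

Lemma vzb_coef j h a ga b de : (vzb C j * h) (idx a ga b de)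
  = if (0 < b j)%N then h (idx a ga (b - U_(j)) de) else 0.
Proof. by rewrite fvarM mcat_r mcat_l mnm1_r mnm1_l !mcatB !subm0. Qed.

Lemma idx1_subw a ga : (idx1 a ga - U_(iw n))%MM = idx1 a ga.-1.
Proof.
rewrite mnm1_r mcatB subm0; congr mcat; apply/mnmP => i.
by rewrite !mnmE (ord1 i) subn1.
Qed.

Lemma vw_coef h a ga b de : (vw C n * h) (idx a ga b de)
  = if (0 < ga)%N then h (idx a ga.-1 b de) else 0.
Proof. by rewrite fvarM mcat_l mcat_r mnmE mnm1_l mcatB idx1_subw subm0. Qed.

Lemma vwb_coef h a ga b de : (vwb C n * h) (idx a ga b de)
  = if (0 < de)%N then h (idx a ga b de.-1) else 0.
Proof. by rewrite fvarM mcat_r mcat_r mnmE mnm1_r mcatB idx1_subw subm0. Qed.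

Definition lsign (l : nat) (j : 'I_n) : C := if (j < l)%N then -1 else 1.

Lemma lsign_neq0 l j : lsign l j != 0.
Proof. by rewrite /lsign; case: ifP => _; rewrite ?oppr_eq0 oner_eq0. Qed.

Lemma lformE l : lform C n l = \sum_j lsign l j *: (vz C j * vzb C j).
Proof.
rewrite /lform [RHS](bigID (fun j : 'I_n => (j < l)%N)) /= -sumrN.
congr (_ + _); apply: eq_big => j; rewrite /lsign.
- by [].
- by move=> ->; rewrite scaleN1r.
- by rewrite leqNgt.
- by rewrite leqNgt => /negbTE ->; rewrite scale1r.
Qed.

(** Up to the factor 2i, the defining series of the hyperquadric. *)
Definition sigma l : fps C (N + N) := vw C n - vwb C n - (2 * 'i) *: lform C n l.

Lemma rhoE l (A : fps C (N + N)) :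
  rho l A = (2 * 'i)^-1 *: (sigma l - (2 * 'i) *: A).
Proof.
by rewrite /rho /im_w /sigma !scalerBr !scalerA mulVf ?twoi_neq0 // !scale1r opprD addrA.
Qed.

Lemma sigma_coefE l (Q : fps C (N + N)) a ga b de : (Q * sigma l) (idx a ga b de)
  = sigma_coef (lsign l) (fun a ga b de => Q (idx a ga b de)) a ga b de.
Proof.
rewrite mulrC /sigma !mulrBl fps_scale_mull !fpsB fpsZ vw_coef vwb_coef.
congr (_ - _ * _); rewrite lformE mulr_suml fps_sum; apply: eq_bigr => j _.
rewrite fps_scale_mull fpsZ -mulrA vz_coef vzb_coef; congr (_ * _).
by case: ltnP.
Qed.

(** The linearization of the mapping equation at the identity, polarized: zbar and
wbar are independent variables and the equation is read modulo sigma instead of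
being restricted to the quadric. *)
Definition chern_moser l (f : 'I_n -> fps C N) (g : fps C N) (D : fps C (N + N)) :=
  holo g - fbar (holo g)
  - (2 * 'i) *: (\sum_j lsign l j *:
        (vzb C j * holo (f j) + vz C j * fbar (holo (f j))))
  - (2 * 'i) *: D.

Lemma mnm_sub1_eq0 a j :
  (if (0 < a j)%N then (a - U_(j))%MM == 0%MM else false) = (a == U_(j)%MM).
Proof.
case: ltnP => [a0|]; last first.
  by rewrite leqn0 => /eqP aj; apply/esym/eqP => e; rewrite e mnm1E eqxx in aj.
have le : (U_(j) <= a)%MM by rewrite lep1mP -lt0n.
by rewrite -(eqm_add2r U_(j)%MM) submK // add0m.
Qed.

Lemma chern_moser_coefE l f g D a ga b de :
  chern_moser l f g D (idx a ga b de)
  = cm_coef (lsign l) (fun j a ga => f j (idx1 a ga))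
      (fun a ga => g (idx1 a ga)) (fun a ga b de => D (idx a ga b de)) a ga b de.
Proof.
rewrite /chern_moser /cm_coef !fpsB !fpsZ fps_sum /idx fbarE !holoE !idx1_eq0.
congr (_ - _ - _ * _ - _); first by case: ifP; rewrite ?rmorph0.
apply: eq_bigr => j _; rewrite fpsZ fpsD -!/(idx _ _ _ _) vzb_coef vz_coef /idx fbarE !holoE.
congr (_ * (_ + _)); rewrite !idx1_eq0 -mnm_sub1_eq0.
  by case: ltnP.
by case: ltnP => // _; case: ifP; rewrite ?rmorph0.
Qed.

(** The part of the hypothesis on A1 and A2 that passes to the difference A2 - A1, the
rank bounds being added.  It forgets the dimension and only keeps a family of
generators. *)
Definition admissible (k : nat) (A : fps C (N + N)) :=
  [/\ forall a ga b de, (mdeg a + ga <= 1)%N -> A (idx a ga b de) = 0,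
      forall a ga b de, (mdeg b + de <= 1)%N -> A (idx a ga b de) = 0
    & forall mu ga nu de, exists r (v : 'I_r -> 'X_{1..n} -> C),
        (r <= k)%N /\ forall b, mdeg b = nu -> exists c : 'I_r -> C,
          forall a, mdeg a = mu -> A (idx a ga b de) = \sum_i c i * v i a].

Lemma bicompE (A : fps C (N + N)) mu nu ga de a b : mdeg a = mu -> mdeg b = nu ->
  bicomp A mu nu ga de (mcat a b) = A (idx a ga b de).
Proof. by move=> ea eb; rewrite /= mleft_mcat mright_mcat ea eb !eqxx. Qed.

Lemma tildeS_admissible k (A : fps C (N + N)) : tildeS k A -> admissible k A.
Proof.
move=> [[realA _] S].
have lowr a ga b de : (mdeg b + de <= 1)%N -> A (idx a ga b de) = 0.
  move=> le1; have := S (mdeg a) (mdeg b) ga de; rewrite le1.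
  by move/(congr1 (fun h : fps C (n + n) => h (mcat a b))); rewrite bicompE.
split=> // [a ga b de le1|mu ga nu de].
  by rewrite -realA /idx fbarE -/(idx b de a ga) lowr ?rmorph0.
have := S mu nu ga de; case: leqP => [le1 _|_ /rank_leP[r [v [le_rk span]]]].
  exists 0%N, (fun _ _ => 0); split=> // b db; exists (fun=> 0) => a _.
  by rewrite lowr ?db // big_ord0.
exists r, v; split=> // b db; have [c cE] := span b.
by exists c => a da; rewrite -cE bicompE.
Qed.

Lemma admissibleB k1 k2 (A1 A2 : fps C (N + N)) :
  admissible k1 A1 -> admissible k2 A2 -> admissible (k1 + k2) (A1 - A2).
Proof.
move=> [l1 r1 R1] [l2 r2 R2]; split=> [a ga b de le1|a ga b de le1|mu ga nu de].
- by rewrite fpsB l1 ?l2 ?subr0.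
- by rewrite fpsB r1 ?r2 ?subr0.
have [d1 [v1 [le1 S1]]] := R1 mu ga nu de; have [d2 [v2 [le2 S2]]] := R2 mu ga nu de.
exists (d1 + d2)%N, (cat_fun v1 v2); split=> [|b db]; first exact: leq_add.
have [c1 E1] := S1 b db; have [c2 E2] := S2 b db.
exists (cat_fun c1 (fun i => - c2 i)) => a da.
rewrite fpsB E1 ?E2 // big_split_ord /= -sumrN.
by congr (_ + _); apply: eq_bigr => i _; rewrite ?cat_fun_l ?cat_fun_r ?mulNr.
Qed.

Lemma admissible_wge4 k A : admissible k A -> wge wt2 4 A.
Proof.
move=> [lowl lowr _] c; have [a [ga [b [de ->]]]] := idx_surj c.
rewrite mwt_idx => lt4; have [/lowl//|gt1] := leqP (mdeg a + ga) 1.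
by apply: lowr; lia.
Qed.

Definition normal_jet (f : 'I_n -> fps C N) (g : fps C N) :=
  [/\ forall j c, (mdeg c <= 1)%N -> f j c = 0,
      forall c, (mdeg c <= 1)%N -> g c = 0
    & 'Re (g (idx1 0%MM 2)) = 0].

(** Only the components of weight s are compared, hence the conclusion only concerns
these: the nonlinear equation agrees with its linearization in one weight at a
time. *)
Lemma weight_rigidity l k s f g D Q :
  normal_jet f g -> admissible k D -> (k < n)%N ->
  (forall c, mwt wt2 c = s -> chern_moser l f g D c = (Q * sigma l) c) ->
  [/\ forall j c, (mwt wt1 c).+1 = s -> f j c = 0,
      forall c, mwt wt1 c = s -> g c = 0,
      forall c, mwt wt2 c = s -> D c = 0
    & forall c, (mwt wt2 c).+2 = s -> Q c = 0].
Proof.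
move=> [f1 g1 g2] [lowl lowr rk] lt_kn eq_s.
have [|||||||Ff Gg DD QQ] := @linear_rigidity C n s _ (lsign_neq0 l)
  (fun j a ga => f j (idx1 a ga)) (fun a ga => g (idx1 a ga))
  (fun a ga b de => D (idx a ga b de)) (fun a ga b de => Q (idx a ga b de)).
- by move=> j a ga le1; rewrite f1 ?mdeg_idx1.
- by move=> a ga le1; rewrite g1 ?mdeg_idx1.
- exact: g2.
- exact: lowl.
- exact: lowr.
- move=> mu ga nu de; have [r [v [le_rk S]]] := rk mu ga nu de.
  by exists r, v; split=> //; exact: leq_ltn_trans lt_kn.
- by move=> a ga b de da; rewrite -chern_moser_coefE -sigma_coefE eq_s ?mwt_idx.
split=> [j c|c|c|c].
- by have [a [ga ->]] := idx1_surj c; rewrite mwt_idx1 -addn1; exact: Ff.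
- by have [a [ga ->]] := idx1_surj c; rewrite mwt_idx1; exact: Gg.
- by have [a [ga [b [de ->]]]] := idx_surj c; rewrite mwt_idx; exact: DD.
- by have [a [ga [b [de ->]]]] := idx_surj c; rewrite mwt_idx -addn2; exact: QQ.
Qed.

End Coordinates.

(** * The nonlinear equation *)

Section Mapping.
Variables (C : numClosedFieldType) (n l : nat).
Local Notation N := (n + 1)%N.
Local Notation wt1 := (@wt1 n).
Local Notation wt2 := (@wt2 n).
Implicit Types (h : fps C N) (B : fps C (N + N)).

Definition cmap (H : 'I_N -> fps C N) : 'I_(N + N) -> fps C (N + N) :=
  cat_fun (fun i => holo (H i)) (fun i => fbar (holo (H i))).

Lemma holo_wge s h : wge wt1 s h -> wge wt2 s (holo h).
Proof.
move=> wh c; rewrite -(mcat_mleftK c) mwt_mcat holoE.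
by case: ifP => // /eqP -> lt_s; apply/wh/(leq_ltn_trans _ lt_s)/leq_addr.
Qed.

Lemma fbar_wge s B : wge wt2 s B -> wge wt2 s (fbar B).
Proof.
move=> wB c; rewrite -(mcat_mleftK c) mwt_mcat fbarE => lt_s.
by rewrite wB ?rmorph0 // mwt_mcat addnC.
Qed.

Lemma wge_vz j : wge wt2 1 (vz C j).
Proof. by have := @wge_fvar C _ wt2 (lshift N (iz j)); rewrite /wt2 cat_fun_l /wt1 cat_fun_l. Qed.
Lemma wge_vzb j : wge wt2 1 (vzb C j).
Proof. by have := @wge_fvar C _ wt2 (rshift N (iz j)); rewrite /wt2 cat_fun_r /wt1 cat_fun_l. Qed.
Lemma wge_vw : wge wt2 2 (vw C n).
Proof. by have := @wge_fvar C _ wt2 (lshift N (iw n)); rewrite /wt2 cat_fun_l /wt1 cat_fun_r. Qed.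
Lemma wge_vwb : wge wt2 2 (vwb C n).
Proof. by have := @wge_fvar C _ wt2 (rshift N (iw n)); rewrite /wt2 cat_fun_r /wt1 cat_fun_r. Qed.

Lemma wge_lform : wge wt2 2 (lform C n l).
Proof.
rewrite lformE; apply: wge_sum => j _; apply: wgeZ.
by apply: (@wgeM _ _ _ 1 1); [exact: wge_vz|exact: wge_vzb].
Qed.

Lemma fcst_wge s B : wge wt2 s.+1 B -> fcst B = 0.
Proof. by move=> wB; apply: wB; rewrite /mwt big1 // => i _; rewrite mnm0E. Qed.

Section Perturbation.
Variables (f : 'I_n -> fps C N) (g : fps C N).
Local Notation Hh := (cmap (pert_id f g)).
Local Notation F j := (holo (f j)).
Local Notation G := (holo g).

Lemma cmap_z j : Hh (lshift N (iz j)) = vz C j + F j.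
Proof. by rewrite /cmap cat_fun_l /pert_id cat_fun_l holoD holo_fvar. Qed.
Lemma cmap_w : Hh (lshift N (iw n)) = vw C n + G.
Proof. by rewrite /cmap cat_fun_l /pert_id cat_fun_r holoD holo_fvar. Qed.
Lemma cmap_zb j : Hh (rshift N (iz j)) = vzb C j + fbar (F j).
Proof. by rewrite /cmap cat_fun_r /pert_id cat_fun_l holoD holo_fvar fbarD fbar_fvar. Qed.
Lemma cmap_wb : Hh (rshift N (iw n)) = vwb C n + fbar G.
Proof. by rewrite /cmap cat_fun_r /pert_id cat_fun_r holoD holo_fvar fbarD fbar_fvar. Qed.

Lemma cmap_close e : (forall j, wge wt1 e.+1 (f j)) -> wge wt1 e.+2 g ->
  forall i, wge wt2 (wt2 i + e) (Hh i - fvar C i).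
Proof.
move=> wf wg i.
case: (split_ordP i) => j -> {i}; case: (split_ordP j) => k -> {j}; rewrite ?(ord1 k).
- rewrite /wt2 cat_fun_l /wt1 cat_fun_l [X in wge _ _ (X - _)]cmap_z addrC addKr.
  exact/holo_wge/wf.
- rewrite /wt2 cat_fun_l /wt1 cat_fun_r [X in wge _ _ (X - _)]cmap_w addrC addKr.
  exact/holo_wge/wg.
- rewrite /wt2 cat_fun_r /wt1 cat_fun_l [X in wge _ _ (X - _)]cmap_zb addrC addKr.
  exact/fbar_wge/holo_wge/wf.
- rewrite /wt2 cat_fun_r /wt1 cat_fun_r [X in wge _ _ (X - _)]cmap_wb addrC addKr.
  exact/fbar_wge/holo_wge/wg.
Qed.

Lemma cmap_wge : (forall j, wge wt1 1 (f j)) -> wge wt1 2 g ->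
  forall i, wge wt2 (wt2 i) (Hh i).
Proof.
move=> wf wg i; rewrite -[Hh i](subrK (fvar C i)); apply: wgeD; last exact: wge_fvar.
by rewrite -[wt2 i]addn0; apply: cmap_close.
Qed.

Lemma sigma_cmap : (forall i, fcst (Hh i) = 0) ->
  fcomp (sigma C n l) Hh = sigma C n l + G - fbar G
   - (2 * 'i) *: (\sum_j lsign C l j *:
        (vzb C j * F j + vz C j * fbar (F j)))
   - (2 * 'i) *: (\sum_j lsign C l j *: (F j * fbar (F j))).
Proof.
move=> H0; rewrite /sigma !fcompB fcompZ !lformE fcomp_sum.
rewrite !fcomp_fvar // -!/(vw _ _) cmap_w cmap_wb.
have -> : \sum_j fcomp (lsign C l j *: (vz C j * vzb C j)) Hh
  = \sum_j lsign C l j *: (vz C j * vzb C j)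
  + \sum_j lsign C l j *: (vzb C j * F j + vz C j * fbar (F j))
  + \sum_j lsign C l j *: (F j * fbar (F j)).
  rewrite -!big_split; apply: eq_bigr => j _ /=.
  rewrite fcompZ fcomp_fvarM // -!scalerDr cmap_z cmap_zb; congr (_ *: _); ring.
rewrite !scalerDr; set x := _ *: _; set y := _ *: _; set z := _ *: _; ring.
Qed.

Lemma fps_scale_mulr (k : C) (h h' : fps C (N + N)) : h * (k *: h') = k *: (h * h').
Proof. by rewrite mulrC fps_scale_mull mulrC. Qed.

(** The terms after Q sigma are those of higher weight. *)
Lemma mapping_equation A1 A2 : (forall i, fcst (Hh i) = 0) ->
  sends_into (pert_id f g) (rho l A1) (rho l A2) ->
  exists Q, chern_moser l f g (A2 - A1) = Q * sigma C n l
   + (2 * 'i) *: (\sum_j lsign C l j *: (F j * fbar (F j)))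
   + (2 * 'i) *: (fcomp A2 Hh - A2) - (2 * 'i) *: (Q * A1).
Proof.
move=> H0 [q qE]; exists (q - 1); move: qE; rewrite -/(cmap _) !rhoE.
rewrite fcompZ fcompB fcompZ sigma_cmap // [q * _]mulrC fps_scale_mull.
move/(congr1 (fun x => (2 * 'i) *: x)).
rewrite !scalerA divff ?twoi_neq0 // !scale1r [_ * q]mulrC /chern_moser !scalerBr.
rewrite -[_ *: ((q - 1) * A1)]fps_scale_mulr.
set x := _ *: _; set y := _ *: _; set z := _ *: _.
move=> /eqP; rewrite -subr_eq0 => /eqP E; apply/eqP; rewrite -subr_eq0 -E.
apply/eqP; ring.
Qed.

End Perturbation.

(** The common features of the identity and of A |-> A^0, under which the hypersurfaces
defined by T A1 and T A2 can be compared through A1 and A2 themselves. *)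
Definition restriction_like (T : fps C (N + N) -> fps C (N + N)) :=
  [/\ forall A1 A2, T (A1 - A2) = T A1 - T A2,
      forall s A, wge wt2 s A -> wge wt2 s (T A)
    & forall A d, exists P, forall c, (mdeg c < d)%N ->
        (T A - A) c = (P * sigma C n l) c].

Lemma normal_jet0 : normal_jet (fun _ : 'I_n => 0 : fps C N) 0.
Proof. by split=> //; rewrite raddf0. Qed.

Lemma admissible0 : admissible 0 (0 : fps C (N + N)).
Proof.
split=> // mu ga nu de; exists 0%N, (fun _ _ => 0); split=> // b _.
by exists (fun=> 0) => a _; rewrite big_ord0.
Qed.

Lemma chern_moser0 : chern_moser l (fun _ : 'I_n => 0 : fps C N) 0 0 = 0.
Proof.
have h0 : holo (0 : fps C N) = 0 by rewrite /holo fcomp0.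
have b0 : fbar (0 : fps C (N + N)) = 0 by apply: fpsP => c; rewrite /= rmorph0.
rewrite /chern_moser h0 b0 big1 ?scaler0 ?subr0 // => j _.
by rewrite !mulr0 addr0 scaler0.
Qed.

(** The linear statement for f = g = 0 and A = 0: multiplication by sigma is injective
and strictly compatible with weights. *)
Lemma sigma_regular s Q : (0 < n)%N ->
  wge wt2 s.+2 (Q * sigma C n l) -> forall c, (mwt wt2 c < s)%N -> Q c = 0.
Proof.
move=> n_gt0 wQ c lt_s.
have [|_ _ _] := @weight_rigidity _ _ l 0 (mwt wt2 c).+2 _ _ _ Q normal_jet0 admissible0 n_gt0.
  by move=> c' wc'; rewrite chern_moser0 wQ // wc'.
exact.
Qed.

Lemma wge_succ (m : nat) (w : 'I_m -> nat) s (h : fps C m) :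
  wge w s h -> (forall c, mwt w c = s -> h c = 0) -> wge w s.+1 h.
Proof.
by move=> wh hs c; rewrite ltnS leq_eqVlt => /orP[/eqP/hs|/wh].
Qed.

Section Iteration.
Variables (T : fps C (N + N) -> fps C (N + N)) (k1 k2 : nat).
Variables (f : 'I_n -> fps C N) (g : fps C N) (A1 A2 : fps C (N + N)).
Hypothesis T_restr : restriction_like T.
Hypothesis jet : normal_jet f g.
Hypothesis adm1 : admissible k1 A1.
Hypothesis adm2 : admissible k2 A2.
Hypothesis lt_n : (k1 + k2 < n)%N.
Hypothesis maps : sends_into (pert_id f g) (rho l (T A1)) (rho l (T A2)).
Local Notation Hh := (cmap (pert_id f g)).

Lemma normal_jet_wge : (forall j, wge wt1 2 (f j)) /\ wge wt1 2 g.
Proof.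
have [f1 g1 _] := jet; split=> [j|] c lt_c; rewrite ?f1 ?g1 //;
  by rewrite -ltnS (leq_ltn_trans _ lt_c) // mdeg_mwt //; exact: wt1_gt0.
Qed.

(** In weight e + 2 the nonlinear terms R1, R2, R3 vanish and T D - D is a multiple
P sigma for D = A2 - A1, so the linear statement applies with Q + 2i P.  It
annihilates the next components of f, g and D; then Q sigma itself vanishes in this
weight, which gives the next component of Q without any knowledge of P. *)
Lemma rigidity_wge e : exists Q,
  [/\ chern_moser l f g (T A2 - T A1) = Q * sigma C n l
        + (2 * 'i) *: (\sum_j lsign C l j *: (holo (f j) * fbar (holo (f j))))
        + (2 * 'i) *: (fcomp (T A2) Hh - T A2) - (2 * 'i) *: (Q * T A1),
      forall j, wge wt1 e.+1 (f j), wge wt1 e.+2 g, wge wt2 e.+2 (A2 - A1)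
    & wge wt2 e Q].
Proof.
have [TB wT T_sigma] := T_restr; have [f2 g2] := normal_jet_wge.
have w1 := admissible_wge4 adm1; have w2 := admissible_wge4 adm2.
have f1 j : wge wt1 1 (f j) by apply: wgeW (f2 j).
have Hh_wge := cmap_wge f1 g2.
have Hh0 i : fcst (Hh i) = 0.
  by apply: (@fcst_wge (wt2 i).-1); rewrite prednK ?wt2_gt0.
have [Q eqQ] := mapping_equation Hh0 maps.
(* Q is fixed before the induction, its order of vanishing being part of what is
   proved. *)
exists Q; elim: e => [|e [_ wf wg wD wQ]].
  by split=> //; apply: (wgeW (s := 4)) => //; apply: wgeB.
have eqR := eqQ.
set R1 := (2 * 'i) *: \sum_j _ in eqR; set R2 := (2 * 'i) *: (_ - T A2) in eqR.
set R3 := (2 * 'i) *: (Q * _) in eqR.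
(* One factor vanishes below e + 1 by induction, the other below 2 because f has
   no linear part; this second bound is needed to start the induction at e = 0. *)
have wR1 : wge wt2 e.+3 R1.
  apply/wgeZ/wge_sum => j _; apply: wgeZ; rewrite -(addn2 e.+1).
  by apply: wgeM; [apply/holo_wge/wf | apply/fbar_wge/holo_wge/f2].
have wR2 : wge wt2 e.+3 R2.
  apply: wgeZ; rewrite -{2}[T A2]fcomp_id; apply: (wgeW (s := 4 + e)); first lia.
  apply: (fcomp_close (u := wt2)) => //; last exact: wT.
    by move=> i; exact: wge_fvar.
  exact: cmap_close.
have wR3 : wge wt2 e.+3 R3.
  apply: wgeZ; apply: (wgeW (s := e + 4)); first lia.
  by apply: wgeM => //; apply: wT.
clearbody R1 R2 R3; pose D := A2 - A1.
have [P PE] := T_sigma D e.+3.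
have eq_lin c : mwt wt2 c = e.+2 ->
    chern_moser l f g D c = ((Q + (2 * 'i) *: P) * sigma C n l) c.
  move=> wc.
  have -> : chern_moser l f g D = chern_moser l f g (T A2 - T A1) + (2 * 'i) *: (T D - D).
    rewrite /chern_moser -TB [_ *: (T D - D)]scalerBr.
    set x := _ *: \sum_j _; set y := _ *: D; set z := _ *: T D.
    ring.
  rewrite eqR [(Q + _) * _]mulrDl fps_scale_mull !fpsD !fpsZ PE; last first.
    by rewrite ltnS -wc; apply: mdeg_mwt; exact: wt2_gt0.
  by rewrite fpsN wR1 ?wR2 ?wR3 ?wc // subr0 !addr0.
have lt_n' : (k2 + k1 < n)%N by rewrite addnC.
have [Ff Gg DD _] := weight_rigidity jet (admissibleB adm2 adm1) lt_n' eq_lin.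
have wf' j : wge wt1 e.+2 (f j).
  by apply: wge_succ => // c wc; apply: Ff; rewrite wc.
have wg' : wge wt1 e.+3 g by exact: wge_succ.
have wD' : wge wt2 e.+3 D by exact: wge_succ.
split=> //; move=> c lt_c.
have n_gt0 : (0 < n)%N by apply: leq_ltn_trans lt_n.
apply: (@sigma_regular e.+1) lt_c => //.
have -> : Q * sigma C n l = chern_moser l f g (T A2 - T A1) - R1 - R2 + R3.
  rewrite eqR; ring.
apply: wgeD => //; apply: wgeB => //; apply: wgeB => //.
rewrite /chern_moser -TB; apply: wgeB; last by apply/wgeZ/wT.
apply: wgeB; first by apply: wgeB; [|apply: fbar_wge]; apply: holo_wge.
apply/wgeZ/wge_sum => j _; apply: wgeZ.
apply: wgeD; apply: (@wgeM _ _ _ 1 e.+2); [exact: wge_vzb| |exact: wge_vz|apply: fbar_wge];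
  exact: holo_wge.
Qed.

Theorem rigidity : [/\ forall j, f j = 0, g = 0 & A1 = A2].
Proof.
split=> [j||].
- by apply: fpsP => c; have [Q [_ wf _ _ _]] := rigidity_wge (mwt wt1 c); apply: wf.
- apply: fpsP => c; have [Q [_ _ wg _ _]] := rigidity_wge (mwt wt1 c).
  by apply: wg; rewrite ltnS ltnW.
- apply: fpsP => c; have [Q [_ _ _ wD _]] := rigidity_wge (mwt wt2 c).
  by apply/esym/eqP; rewrite -subr_eq0; apply/eqP/wD; rewrite ltnS ltnW.
Qed.

End Iteration.

Lemma restriction_like_id : restriction_like id.
Proof. by split=> // A d; exists 0 => c _; rewrite subrr mul0r. Qed.

(** The substituted series differ from w and wbar by - sigma / 2 and sigma / 2. *)
Lemma restriction_like_restr0 : restriction_like (restr0 l).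
Proof.
pose S : 'I_(N + N) -> fps C (N + N) :=
  cat_fun (cat_fun (@vz C n) (fun=> re_w C n + 'i *: lform C n l))
          (cat_fun (@vzb C n) (fun=> re_w C n - 'i *: lform C n l)).
have half_sigma : 2^-1 *: sigma C n l = 2^-1 *: (vw C n - vwb C n) - 'i *: lform C n l.
  by rewrite /sigma scalerBr scalerA mulKf // pnatr_eq0.
have half (B : fps C (N + N)) : B = 2^-1 *: B + 2^-1 *: B.
  by rewrite -scalerDl -mulr2n -[2^-1 *+ 2]mulr_natr mulVf ?pnatr_eq0 // scale1r.
have re_vw : re_w C n - vw C n = - (2^-1 *: (vw C n - vwb C n)).
  rewrite [X in _ - X]half /re_w scalerBr scalerDr.
  set x := _ *: _; set y := _ *: _; ring.
have re_vwb : re_w C n - vwb C n = 2^-1 *: (vw C n - vwb C n).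
  rewrite [X in _ - X]half /re_w scalerBr scalerDr.
  set x := _ *: _; set y := _ *: _; ring.
have wre : wge wt2 2 (re_w C n).
  by apply/wgeZ/wgeD; [exact: wge_vw|exact: wge_vwb].
have wS i : wge wt2 (wt2 i) (S i).
  have wl := wge_lform.
  case: (split_ordP i) => j -> {i}; case: (split_ordP j) => k -> {j}; rewrite ?(ord1 k) /S.
  - by rewrite !cat_fun_l /wt2 cat_fun_l /wt1 cat_fun_l; exact: wge_vz.
  - rewrite cat_fun_l cat_fun_r /wt2 cat_fun_l /wt1 cat_fun_r.
    by apply: wgeD => //; apply: wgeZ.
  - by rewrite cat_fun_r cat_fun_l /wt2 cat_fun_r /wt1 cat_fun_l; exact: wge_vzb.
  - rewrite !cat_fun_r /wt2 cat_fun_r /wt1 cat_fun_r.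
    by apply: wgeB => //; apply: wgeZ.
have cst0 (X : 'I_(N + N) -> fps C (N + N)) :
    (forall i, wge wt2 (wt2 i) (X i)) -> forall i, fcst (X i) = 0.
  by move=> wX i; apply: (@fcst_wge (wt2 i).-1); rewrite prednK ?wt2_gt0.
have S_sigma i : exists y, S i - fvar C i = y * sigma C n l.
  case: (split_ordP i) => j -> {i}; case: (split_ordP j) => k -> {j}; rewrite ?(ord1 k) /S.
  - by exists 0; rewrite !cat_fun_l subrr mul0r.
  - exists (- 2^-1 *: (1 : fps C (N + N))); rewrite cat_fun_l cat_fun_r -[fvar _ _]/(vw C n).
    by rewrite fps_scale_mull mul1r scaleNr half_sigma addrAC re_vw opprB addrC.
  - by exists 0; rewrite cat_fun_r cat_fun_l subrr mul0r.
  - exists (2^-1 *: (1 : fps C (N + N))); rewrite !cat_fun_r -[fvar _ _]/(vwb C n).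
    by rewrite fps_scale_mull mul1r half_sigma addrAC re_vwb.
split=> [A1 A2|s A wA|A d].
- exact: fcompB.
- exact: fcomp_wge wS wA.
- have [y yE] := fcomp_congr A d (cst0 _ wS) (cst0 _ (@wge_fvar C _ wt2)) S_sigma.
  by exists y => c /yE; rewrite fcomp_id.
Qed.

End Mapping.

(** * Low order terms of a normalized map *)

Lemma fcst_fderivm (K : comNzRingType) (m : nat) (b : 'X_{1..m}) (h : fps K m) :
  fcst (fderivm b h) = h b *+ \prod_i (b i)`!.
Proof.
rewrite /fcst /= addm0; congr (_ *+ _).
by apply: eq_bigr => i _; rewrite ffactnn.
Qed.

Lemma fcst_fderivm_eq0 (C : numDomainType) (m : nat) (b : 'X_{1..m}) (h : fps C m) :
  fcst (fderivm b h) = 0 -> h b = 0.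
Proof.
rewrite fcst_fderivm => /eqP; rewrite mulrn_eq0 => /orP[|/eqP//].
by rewrite eqn0Ngt prodn_gt0 // => i; rewrite fact_gt0.
Qed.

Lemma normalized_jet (C : numClosedFieldType) (n : nat)
    (f : 'I_n -> fps C (n + 1)) (g : fps C (n + 1)) :
  (forall i, fcst (pert_id f g i) = 0) -> normalized f g -> normal_jet f g.
Proof.
move=> H0 [f1 g1 g2].
have fvar0 i : fvar C i (0%MM : 'X_{1..n + 1}) = 0 by rewrite /= mnm1_eq0.
have low (h : fps C (n + 1)) : fcst h = 0 ->
    (forall i, fcst (fderivm U_(i)%MM h) = 0) ->
    forall c, (mdeg c <= 1)%N -> h c = 0.
  move=> h0 h1 c; rewrite leq_eqVlt => /orP[/mdeg1P[i /eqP->]|].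
    exact: fcst_fderivm_eq0 (h1 i).
  by rewrite ltnS leqn0 mdeg_eq0 => /eqP ->.
split=> [j||].
- apply: low (f1 j); have := H0 (iz j).
  by rewrite /pert_id cat_fun_l /fcst fpsD fvar0 add0r.
- apply: low g1; have := H0 (iw n).
  by rewrite /pert_id cat_fun_r /fcst fpsD fvar0 add0r.
have -> : idx1 (0%MM : 'X_{1..n}) 2 = (U_(iw n) + U_(iw n))%MM.
  rewrite mnm1_r mcatD addm0; congr mcat; apply/mnmP => i.
  by rewrite !mnmE (ord1 i).
move: g2; rewrite fcst_fderivm raddfMn => /eqP; rewrite mulrn_eq0 => /orP[|/eqP//].
by rewrite eqn0Ngt prodn_gt0 // => i; rewrite fact_gt0.
Qed.

Theorem theorem4p3 (R : realType) (n l k1 k2 : nat)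
    (A1 A2 : fps (Cplx R) (n + 1 + (n + 1)))
    (f : 'I_n -> fps (Cplx R) (n + 1)) (g : fps (Cplx R) (n + 1)) :
  (l.*2 <= n)%N -> (0 < k1)%N -> (0 < k2)%N ->
  tildeS k1 A1 -> tildeS k2 A2 ->
  formal_map_biholomorphic (pert_id f g) ->
  normalized f g ->
  sends_into (pert_id f g) (rho l A1) (rho l A2) \/
  sends_into (pert_id f g) (rho0 l A1) (rho0 l A2) ->
  (k1 + k2 < n)%N ->
  (forall i, pert_id f g i = fvar (Cplx R) i) /\ A1 = A2.
Proof.
move=> _ _ _ /tildeS_admissible adm1 /tildeS_admissible adm2 [H0 _].
move=> /(normalized_jet H0) jet maps lt_n.
have [f0 g0 eqA] : [/\ forall j, f j = 0, g = 0 & A1 = A2].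
  case: maps => maps.
    exact: rigidity (restriction_like_id _ _ _) jet adm1 adm2 lt_n maps.
  exact: rigidity (restriction_like_restr0 _ _ _) jet adm1 adm2 lt_n maps.
split=> // i; rewrite /pert_id.
by case: (split_ordP i) => j ->; rewrite ?cat_fun_l ?cat_fun_r ?f0 ?g0 addr0 // (ord1 j).
Qed.
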